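(* Let $(A,\Phi,V,H)$ be a $C^*$-Eberlein algebra with $A$ unital. Then $A$ has a left invariant mean.
   Context: For a $C^*$-algebra $A$, $A^{**}$ is its bidual von Neumann algebra and $\overline\otimes$ is the von Neumann algebra tensor product. For $V\in A^{**}\overline\otimes\mathcal B(H)$, $\mu\in A^*$, $\omega\in\mathcal B(H)_*$ write $(\mu\otimes\mathrm{id})(V)\in\mathcal B(H)$ and $(\mathrm{id}\otimes\omega)(V)\in A^{**}$ for the slices. A $C^*$-Eberlein algebra is a quadruple $(A,\Phi,V,H)$ where: (1) $A$ is a $C^*$-algebra, $\Phi:A\to A^{**}\overline\otimes A^{**}$ is a unital $*$-homomorphism, $H$ is a Hilbert space and $V\in A^{**}\overline\otimes\mathcal B(H)$ is a contraction; (2) $A_V:=\{(\mathrm{id}\otimes\omega)(V):\omega\in\mathcal B(H)_*\}$ is a subset of $A\subseteq A^{**}$ and is norm dense in $A$; (3) the bilinear product on $A^*$ given by $\langle\mu\star\nu,a\rangle=\langle\Phi(a),\mu\otimes\nu\rangle$ is associative; (4) the map $A^*\to\mathcal B(H)$, $\mu\mapsto(\mu\otimes\mathrm{id})(V)$ is a homomorphism for $\star$. $A^{**}$ is an $A^*$-bimodule via $\langle x\cdot\mu,\lambda\rangle=\langle x,\mu\star\lambda\rangle$ and $\langle\mu\cdot x,\lambda\rangle=\langle x,\lambda\star\mu\rangle$, and $A$ is a sub-bimodule. A state $M\in A^*$ is a left invariant mean if $\langle M,a\cdot\mu\rangle=\langle M,a\rangle$ for all states $\mu\in A^*$ and all $a\in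 A$. *)

(* Defs.v *)
(* C*-Eberlein algebras over MathComp-Analysis.  R : realType, and the scalars
   are the complex numbers R[i]; R[i]^o is R[i] seen as a normed module. *)
From HB Require Import structures.
From mathcomp Require Import all_boot all_order all_algebra.
From mathcomp Require Import all_classical all_reals all_analysis.
From mathcomp Require Export complex.

Set Implicit Arguments.
Unset Strict Implicit.
Unset Printing Implicit Defensive.
Import Order.TTheory GRing.Theory Num.Theory.
Import numFieldNormedType.Exports.

Local Open Scope classical_set_scope.
Local Open Scope ring_scope.
Local Open Scope complex_scope.

(* C*-algebras, possibly without unit. *)
HB.mixin Record isCStarAlgebra (R : realType) A
    of CompleteNormedModule R[i] A := {
  cmul : A -> A -> A ;
  adj : A -> A ;
  cmulA : associative cmul ;
  cmul_linearl : forall b : A, linear (cmul^~ b) ;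
  cmul_linearr : forall a : A, linear (cmul a) ;
  adjK : involutive adj ;
  adjD : {morph adj : x y / x + y} ;
  adjZ : forall (c : R[i]) (x : A), adj (c *: x) = Num.conj c *: adj x ;
  adjM : forall x y : A, adj (cmul x y) = cmul (adj y) (adj x) ;
  cstar_normM : forall x y : A, `|cmul x y| <= `|x| * `|y| ;
  cstar_normE : forall x : A, `|cmul (adj x) x| = `|x| ^+ 2
}.

#[short(type="cstarType")]
HB.structure Definition CStarAlgebra (R : realType) :=
  { A of CompleteNormedModule R[i] A & isCStarAlgebra R A }.

(* The zero algebra does not count as unital. *)
Definition unital (R : realType) (A : cstarType R) : Prop :=
  exists e : A, [/\ e != 0, left_id e cmul & right_id e cmul].

(* The inner product is linear on the left, conjugate linear on the right. *)
HB.mixin Record isHilbert (R : realType) H of CompleteNormedModule R[i] H := {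
  inner : {dot H for Num.conj} ;
  inner_norm : forall x : H, `|x| ^+ 2 = inner x x
}.

#[short(type="hilbertType")]
HB.structure Definition Hilbert (R : realType) :=
  { H of CompleteNormedModule R[i] H & isHilbert R H }.

Notation "''<' x , y '>'" := (inner x y)
  (at level 2, x, y at level 69, format "''<' x ,  y '>'").

Section Operators.
Context {R : realType}.
Notation C := (R[i]^o).

(* Bounded linear maps: between normed spaces, boundedness is continuity. *)
Definition bounded_linear (U W : normedModType R[i]) : set (U -> W) :=
  [set f | linear f /\ continuous f].

(* A^* *)
Definition bdual (A : normedModType R[i]) : set (A -> C) :=
  @bounded_linear A C.

(* B(H) *)
Definition bops (H : hilbertType R) : set (H -> H) := @bounded_linear H H.

Definition csum (u : nat -> C) : C := limn (series u).

(* A pair (x, y) of square-summable sequences encodes the normal functional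
   T |-> \sum_n <T x_n, y_n> on B(H); every element of B(H)_* is of this form. *)
Definition nform (H : hilbertType R) : Type := ((nat -> H) * (nat -> H))%type.

Definition sqsummable (H : hilbertType R) (x : nat -> H) : Prop :=
  cvgn (series (fun n => `|x n| ^+ 2 : C)).

Definition normal (H : hilbertType R) : set (nform H) :=
  [set w | sqsummable w.1 /\ sqsummable w.2].

Definition nval (H : hilbertType R) (w : nform H) (T : H -> H) : C :=
  csum (fun n => '<T (w.1 n), w.2 n>).

(* closure in B(H) for the ultraweak (= weak-star) topology *)
Definition uw_closure (H : hilbertType R) (S : set (H -> H)) : set (H -> H) :=
  [set T | bops T /\
    forall (n : nat) (w : 'I_n -> nform H), (forall i, normal (w i)) ->
    forall e : R, 0 < e ->
    exists2 s, S s & forall i, `|nval (w i) T - nval (w i) s| < e%:C].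

(* (L, t) is a Hilbert space tensor product of K and H. *)
Definition hilbert_tensor (K H L : hilbertType R) (t : K -> H -> L) : Prop :=
  [/\ forall k, linear (t k),
      forall h, linear (t ^~ h),
      forall k h k' h', '<t k h, t k' h'> = '<k, k'> * '<h, h'>
    & dense [set z | exists n (k : 'I_n -> K) (h : 'I_n -> H),
                       z = \sum_(i < n) t (k i) (h i)]].

Section Tensor.
Variables (K H L : hilbertType R) (t : K -> H -> L).

Definition op_tensor (x : K -> K) (y : H -> H) (T : L -> L) : Prop :=
  bops T /\ forall k h, T (t k h) = t (x k) (y h).

Definition alg_tensor (M : set (K -> K)) (N : set (H -> H)) : set (L -> L) :=
  [set T | exists n (s : 'I_n -> L -> L),
    (forall i, exists x y, [/\ M x, N y & op_tensor x y (s i)]) /\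
    forall z, T z = \sum_(i < n) s i z].

Definition vn_tensor (M : set (K -> K)) (N : set (H -> H)) : set (L -> L) :=
  uw_closure (alg_tensor M N).

(* value at X of the product of the normal functionals u and v *)
Definition tensor_val (X : L -> L) (u : nform K) (v : nform H) : C :=
  csum (fun n => csum (fun m =>
    '<X (t (u.1 n) (v.1 m)), t (u.2 n) (v.2 m)>)).

(* the vector x with <x, y> = g y for all y *)
Definition riesz (G : hilbertType R) (g : G -> C) : G :=
  xget 0 [set x | forall y, '<x, y> = g y].

(* (u (x) id)(X), with matrix coefficients <(u (x) id)(X) h, h'>
   = \sum_n <X (x_n (x) h), y_n (x) h'> for u = (x, y) *)
Definition lslice (u : nform K) (X : L -> L) : H -> H :=
  fun h => riesz (fun h' =>
    csum (fun n => '<X (t (u.1 n) h), t (u.2 n) h'>)).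

(* (id (x) v)(X) *)
Definition rslice (v : nform H) (X : L -> L) : K -> K :=
  fun k => riesz (fun k' =>
    csum (fun m => '<X (t k (v.1 m)), t k' (v.2 m)>)).

End Tensor.

Section Bidual.
Variable A : cstarType R.

Definition positive : set (A -> C) :=
  [set mu | forall a, (0 : R[i]) <= mu (cmul (adj a) a)].

(* positive functionals of norm 1 *)
Definition state : set (A -> C) :=
  [set mu | [/\ bdual mu, positive mu, forall a, `|mu a| <= `|a|
    & forall c : R[i], (forall a, `|mu a| <= c * `|a|) -> 1 <= c]].

(* *-homomorphisms from A to B(G) *)
Definition star_rep (G : hilbertType R) (pi : A -> G -> G) : Prop :=
  [/\ forall a, bops (pi a),
      forall (c : R[i]) a b x, pi (c *: a + b) x = c *: pi a x + pi b x,
      forall a b x, pi (cmul a b) x = pi a (pi b x)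
    & forall a x y, '<pi (adj a) x, y> = '<x, pi a y> ].

Variables (K : hilbertType R) (pi : A -> K -> K).

(* pi is the universal representation of A: the Hilbert space direct sum, over
   all states mu, of the GNS representations (with cyclic vectors xi mu). *)
Definition universal_rep : Prop :=
  star_rep pi /\ exists xi : (A -> C) -> K,
  [/\ forall mu a, state mu -> '<pi a (xi mu), xi mu> = mu a,
      forall mu nu a b, state mu -> state nu -> mu <> nu ->
        '<pi a (xi mu), pi b (xi nu)> = 0
    & dense [set z | exists n (a : 'I_n -> A) (mu : 'I_n -> A -> C),
        (forall i, state (mu i)) /\ z = \sum_(i < n) pi (a i) (xi (mu i))]].

(* A^{**}, as the universal enveloping von Neumann algebra of A *)
Definition bidual : set (K -> K) := uw_closure (range pi).

(* The normal functional on A^{**} given by mu in A^*.  Its values on A^{**} do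
   not depend on the chosen sequences, as pi(A) is ultraweakly dense there. *)
Definition normal_ext (mu : A -> C) : nform K :=
  xget (fun=> 0, fun=> 0)
    [set w | normal w /\ forall a, nval w (pi a) = mu a].

(* The extension of Phi : A -> B(G) to a normal map A^{**} -> B(G) is unital. *)
Definition unital_ext (G : hilbertType R) (Phi : A -> G -> G) : Prop :=
  exists Phi2 : (K -> K) -> (G -> G),
  [/\ forall a, Phi2 (pi a) = Phi a,
      forall w, normal w -> exists2 u : nform K, normal u &
        forall T, bidual T -> nval w (Phi2 T) = nval u T
    & Phi2 id = id].

End Bidual.

Section Eberlein.
Variables (A : cstarType R) (K : hilbertType R) (pi : A -> K -> K).
Variables (KK : hilbertType R) (tK : K -> K -> KK).

(* the product of mu and nu in A^* : a |-> <Phi(a), mu (x) nu> *)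
Definition conv (Phi : A -> KK -> KK) (mu nu : A -> C) : A -> C :=
  fun a => tensor_val tK (Phi a) (normal_ext pi mu) (normal_ext pi nu).

(* C*-Eberlein algebras (A, Phi, V, H), where A^{**} acts on K through pi, and
   KK and KH are the Hilbert spaces K (x) K and K (x) H. *)
Record cstar_eberlein (H KH : hilbertType R) (tH : K -> H -> KH)
    (Phi : A -> KK -> KK) (V : KH -> KH) : Prop := {
  eb_universal : universal_rep pi ;
  eb_tensorKK : hilbert_tensor tK ;
  eb_tensorKH : hilbert_tensor tH ;
  eb_Phi_hom : star_rep Phi ;
  eb_Phi_range : forall a, vn_tensor tK (bidual pi) (bidual pi) (Phi a) ;
  eb_Phi_unital : unital_ext pi Phi ;
  eb_V_range : vn_tensor tH (bidual pi) (@bops H) V ;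
  eb_V_contraction : forall z, `|V z| <= `|z| ;
  eb_slice_sub : forall v, normal v -> exists a, rslice tH v V = pi a ;
  eb_slice_dense :
    dense [set a | exists2 v, normal v & rslice tH v V = pi a] ;
  eb_assoc : forall mu nu la, bdual mu -> bdual nu -> bdual la ->
    conv Phi (conv Phi mu nu) la = conv Phi mu (conv Phi nu la) ;
  eb_slice_hom : forall mu nu, bdual mu -> bdual nu ->
    lslice tH (normal_ext pi (conv Phi mu nu)) V =
    lslice tH (normal_ext pi mu) V \o lslice tH (normal_ext pi nu) V
}.

(* x . mu for x in A^{**}, with A^{**} seen here as functionals on A^* *)
Definition bidual_act (Phi : A -> KK -> KK) (x : (A -> C) -> C) (mu : A -> C) :
    (A -> C) -> C :=
  fun la => x (conv Phi mu la).

Definition canon (a : A) : (A -> C) -> C := fun la => la a.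

(* <M, a . mu> = <M, a>, the left-hand side being the value at M of a . mu *)
Definition left_invariant_mean (Phi : A -> KK -> KK) (M : A -> C) : Prop :=
  state M /\ forall mu a, state mu -> bidual_act Phi (canon a) mu M = canon a M.

End Eberlein.
End Operators.

(* Main.v *)
(* For a state mu let T(mu) = (mu (x) id)(V).  This is a contraction on H whose
   matrix coefficients are mu applied to elements of A, so T is continuous from
   the weak-* to the weak operator topology; it turns the product of states into
   composition, and it is injective on states because the slices of V are dense
   in A.  For h in H, weak-* compactness of the state space yields a state mu
   with |T(mu) h| minimal; by the parallelogram law T(nu) T(mu) h = T(mu) h for
   all states nu.  Multiplying such states handles finitely many h at once, and
   compactness then handles all h with one state M.  Thus T(nu * M) = T(M), and
   nu * M = M by injectivity.

   The argument needs one state to start from, which requires the theorem that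
   elements a^* a of a C*-algebra are positive.  This can be
   had without functional calculus: the top of the spectrum of a self-adjoint h
   is the infimum umax h of |t + h| - t, which is a sublinear functional; once
   umax (- a^* a) <= 0 is known, the Hahn-Banach theorem applied to umax gives
   a state. *)

(* The usual proof that [a^* a] is positive cuts out its negative part by functional calculus. The
   substitute here is amplification. With [b = a^* a], the top of the spectrum of [- b] is at most
   the larger of 0 and that of [b], for every [a] at once. If [- b] had a positive top, passing from
   [a] to [a (p - b)], with [p] the top of [b], would multiply the ratio of the two tops by more
   than 6; repeating this would push the ratio past 1. The analytic inputs are a square root of
   [1 - y] found as a fixed point, and powers of exponent [2^k], whose norms the C*-identity
   computes exactly.

   On the Eberlein side, slices and products are computed from square-summable sequences that are
   merely chosen to represent a functional. A state [mu] is also the vector functional of [xi mu],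
   and ultraweak density of [pi(A)] lets this vector replace the sequences. The product of [mu] and
   [nu] then becomes the vector state of [xi mu (x) xi nu] composed with [Phi], which is why the
   states are closed under the product. *)
From HB Require Import structures.
Require Import Defs.
From mathcomp Require Import all_boot all_order all_algebra.
From mathcomp Require Import all_classical all_reals all_analysis.
From mathcomp Require Import ring lra.
Set Implicit Arguments.
Unset Strict Implicit.
Unset Printing Implicit Defensive.
Import Order.TTheory GRing.Theory Num.Theory.
Import numFieldNormedType.Exports.
Local Open Scope classical_set_scope.
Local Open Scope ring_scope.
Local Open Scope complex_scope.

(** * Real-valued norms *)

Section RealNorm.
Context {R : realType}.

(* Norms in normed modules over [R[i]] are values in [R[i]]; [rnorm] is the
   real number behind them. *)
Definition rnorm (V : normedZmodType R[i]) (x : V) : R := complex.Re `|x|.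

Lemma nonneg_Re (c : R[i]) : 0 <= c -> c = (complex.Re c)%:C /\ 0 <= complex.Re c.
Proof.
by rewrite lecE /= => /andP[/eqP h ->]; rewrite {1}[c]complexE h mulr0 addr0.
Qed.

Section Zmod.
Variable V : normedZmodType R[i].
Implicit Types x y z : V.

Lemma rnormE x : `|x| = (rnorm x)%:C.
Proof. by have [] := nonneg_Re (normr_ge0 x). Qed.

Lemma rnorm_ge0 x : 0 <= rnorm x.
Proof. by have := normr_ge0 x; rewrite rnormE lecR. Qed.

Lemma rnormN x : rnorm (- x) = rnorm x.
Proof. by rewrite /rnorm normrN. Qed.

Lemma rnormBC x y : rnorm (x - y) = rnorm (y - x).
Proof. by rewrite /rnorm distrC. Qed.

Lemma rnormD x y : rnorm (x + y) <= rnorm x + rnorm y.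
Proof. by have := ler_normD x y; rewrite !rnormE -rmorphD lecR. Qed.

Lemma rnormB x y : rnorm (x - y) <= rnorm x + rnorm y.
Proof. by rewrite -[rnorm y]rnormN rnormD. Qed.

Lemma rnorm_dist z x y : rnorm (x - y) <= rnorm (x - z) + rnorm (z - y).
Proof. by apply: le_trans (rnormD _ _); rewrite addrA subrK. Qed.

Lemma rnorm0 : rnorm (0 : V) = 0.
Proof. by rewrite /rnorm normr0. Qed.

Lemma rnorm0_eq0 x : rnorm x <= 0 -> x = 0.
Proof.
move=> h; apply/eqP; rewrite -normr_eq0 rnormE.
by have -> : rnorm x = 0 by apply/eqP; rewrite eq_le h rnorm_ge0.
Qed.

Lemma rnorm_gt0 x : (0 < rnorm x) = (x != 0).
Proof. by rewrite -(normr_gt0 x) rnormE ltcR. Qed.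

Lemma rnorm_eq_eps x y : (forall d : R, 0 < d -> rnorm (x - y) <= d) -> x = y.
Proof.
move=> h; apply/subr0_eq/rnorm0_eq0; case: (lerP (rnorm (x - y)) 0) => // h0.
by have := h (rnorm (x - y) / 2); rewrite divr_gt0 // => /(_ isT); lra.
Qed.

Lemma rnorm_sum (I : Type) (s : seq I) (P : pred I) (F : I -> V) :
  rnorm (\sum_(i <- s | P i) F i) <= \sum_(i <- s | P i) rnorm (F i).
Proof.
elim/big_rec2: _ => [|i y x _ h]; first by rewrite rnorm0.
by apply: le_trans (rnormD _ _) _; rewrite lerD2l.
Qed.
End Zmod.

Lemma rnormM (c d : R[i]) : rnorm (c * d) = rnorm c * rnorm d.
Proof. by have := normrM c d; rewrite !rnormE -rmorphM => -[]. Qed.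

Lemma rnormR (r : R) : rnorm (r%:C) = `|r|.
Proof. by rewrite /rnorm normc_def /= expr0n /= addr0 sqrtr_sqr. Qed.

Lemma rnormZ (V : normedModType R[i]) (c : R[i]) (x : V) :
  rnorm (c *: x) = rnorm c * rnorm x.
Proof. by have := normrZ c x; rewrite !rnormE -rmorphM => -[]. Qed.

Lemma ler_Re (c : R[i]) : complex.Re c <= rnorm c.
Proof.
have := normc_ge_Re c; rewrite rnormE lecR; exact: le_trans (ler_norm _).
Qed.

Lemma ler_absRe (c : R[i]) : `|complex.Re c| <= rnorm c.
Proof. by have := normc_ge_Re c; rewrite rnormE lecR. Qed.

Lemma rnorm_conj (c : R[i]) : rnorm (Num.conj c) = rnorm c.
Proof. by rewrite /rnorm norm_conjC. Qed.

Lemma rnormi : rnorm ('i : R[i]) = 1.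
Proof. by rewrite /rnorm normc_def /= expr0n /= add0r expr1n sqrtr1. Qed.

Lemma rnorm_sqr (c : R[i]) :
  rnorm c ^+ 2 = complex.Re c ^+ 2 + complex.Im c ^+ 2.
Proof. by have := add_Re2_Im2 c; rewrite rnormE -rmorphXn => -[]. Qed.

Lemma rnorm_le_ReIm (c : R[i]) : rnorm c <= `|complex.Re c| + `|complex.Im c|.
Proof.
rewrite {1}[c]complexE; apply: le_trans (rnormD _ _) _.
by rewrite rnormM !rnormR complexiE rnormi mul1r.
Qed.

Lemma ler_absIm (c : R[i]) : `|complex.Im c| <= rnorm c.
Proof.
rewrite -(@ler_sqr _ `|_|) ?nnegrE ?rnorm_ge0 // rnorm_sqr real_normK ?num_real //.
by rewrite lerDr sqr_ge0.
Qed.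

Lemma gt0_Re (c : R[i]) : 0 < c -> 0 < complex.Re c /\ c = (complex.Re c)%:C.
Proof. by move=> c0; have [h _] := nonneg_Re (ltW c0); move: c0; rewrite h ltcR. Qed.

Lemma ball_rnorm (V : normedModType R[i]) (x : V) (r : R) :
  ball x r%:C = [set y | rnorm (x - y) < r].
Proof. by rewrite -ball_normE /ball_ /= ; apply/seteqP; split => y /=; rewrite rnormE ltcR. Qed.

Lemma nbhs_rnorm (V : normedModType R[i]) (x : V) (U : set V) :
  nbhs x U <-> exists2 r : R, 0 < r & forall y, rnorm (x - y) < r -> U y.
Proof.
split.
  move=> /nbhs_ballP[e /= e0 h].
  have [e1 e2] := gt0_Re e0.
  exists (complex.Re e) => // y hy; apply: h; rewrite e2 ball_rnorm //.
move=> [r r0 h]; apply/nbhs_ballP; exists r%:C; first by rewrite /= ltcR.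
by rewrite ball_rnorm => y; exact: h.
Qed.

Lemma cvg_rnorm (V : normedModType R[i]) T (F : set_system T) (f : T -> V) (x : V) :
  Filter F ->
  (f @ F --> x) <->
  (forall r : R, 0 < r -> F [set t | rnorm (x - f t) < r]).
Proof.
move=> FF; split.
  move=> h r r0; apply: (h [set y | rnorm (x - y) < r]).
  by apply/nbhs_rnorm; exists r.
by move=> h U /nbhs_rnorm[r r0 hU]; apply: filterS (h r r0) => t; exact: hU.
Qed.

(** Completeness for approximate solutions: think of [S e] as the points that solve a problem up to
    [e]. It produces both the minimiser in the Riesz theorem and the fixed point behind square
    roots. No [S e] is assumed closed, so the limit is only approached from each of them. *)
Lemma complete_nested (V : completeNormedModType R[i]) (S : R -> set V) :
  (forall e : R, 0 < e -> S e !=set0) ->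
  (forall e e', e <= e' -> S e `<=` S e') ->
  (forall d : R, 0 < d -> exists2 e : R, 0 < e &
     forall x y, S e x -> S e y -> rnorm (x - y) <= d) ->
  exists x, forall e d : R, 0 < e -> 0 < d -> exists2 y, S e y & rnorm (x - y) <= d.
Proof.
move=> S0 Smono Sdiam; pose F := filter_from [set e : R | 0 < e] S.
have FF : ProperFilter F.
  apply: filter_from_proper; last by move=> e /S0.
  apply: filter_from_filter; first by exists 1 => /=.
  move=> i j /= i0 j0; exists (Num.min i j); first by rewrite /= lt_min i0.
  by move=> x h; split; apply: Smono h; rewrite ge_min lexx ?orbT.
have : cvg F.
  apply: cauchy_cvg; apply/cauchyP => e e0.
  have [e1 e2] := gt0_Re e0.
  have [d d0 hd] := Sdiam (complex.Re e / 2) (divr_gt0 e1 (ltr0Sn _ 1)).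
  have [x Sx] := S0 d d0; exists x; exists d => // y Sy /=.
  by rewrite e2 ball_rnorm /=; have := hd x y Sx Sy; lra.
move=> /cvg_ex[x Fx]; exists x => e d e0 d0.
have /Fx[e' /= e'0 h] : nbhs x [set y | rnorm (x - y) < d].
  by apply/nbhs_rnorm; exists d.
have [|y Sy] := S0 (Num.min e e'); first by rewrite lt_min e0.
exists y; first by apply: Smono Sy; rewrite ge_min lexx.
by apply/ltW/h; apply: Smono Sy; rewrite ge_min lexx orbT.
Qed.

End RealNorm.

(** * Hilbert spaces *)

Section HilbertSpace.
Context {R : realType} (H : hilbertType R).
Implicit Types x y z h : H.

Lemma inner_conj x y : '<x, y> = Num.conj '<y, x>.
Proof. by rewrite (hermC inner) /= expr0 mul1r. Qed.

Lemma innerDl x y z : '<x + y, z> = '<x, z> + '<y, z>.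
Proof. exact: linearDl. Qed.

Lemma innerDr x y z : '<x, y + z> = '<x, y> + '<x, z>.
Proof. exact: linearDr. Qed.

Lemma innerZl (c : R[i]) x y : '<c *: x, y> = c * '<x, y>.
Proof. exact: linearZl_LR. Qed.

Lemma innerZr (c : R[i]) x y : '<x, c *: y> = Num.conj c * '<x, y>.
Proof. exact: linearZr_LR. Qed.

Lemma innerBl x y z : '<x - y, z> = '<x, z> - '<y, z>.
Proof. exact: linearBl. Qed.

Lemma innerBr x y z : '<x, y - z> = '<x, y> - '<x, z>.
Proof. exact: linearBr. Qed.

Lemma inner0l x : '<0, x> = 0.
Proof. exact: linear0l. Qed.

Lemma inner0r x : '<x, 0> = 0.
Proof. exact: linear0r. Qed.

Lemma inner_self x : '<x, x> = (rnorm x ^+ 2)%:C.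
Proof. by rewrite -inner_norm rnormE rmorphXn. Qed.

Lemma inner_ext x y : (forall z, '<x, z> = '<y, z>) -> x = y.
Proof.
move=> h; apply/subr0_eq/eqP; have /eqP := inner_self (x - y).
rewrite {1}innerBl h subrr eq_sym => /eqP; rewrite -[0]/(0%:C) => -[] /eqP.
by rewrite expf_eq0 /= => /eqP h0; apply/eqP/rnorm0_eq0; rewrite h0.
Qed.

Lemma rnormD_sqr x y :
  rnorm (x + y) ^+ 2 = rnorm x ^+ 2 + rnorm y ^+ 2 + 2 * complex.Re '<x, y>.
Proof.
have := inner_self (x + y); rewrite innerDl !innerDr !inner_self (inner_conj y x).
move/(congr1 (@complex.Re R)) => /= <-; case: '<x, y> => a b /=; lra.
Qed.

Lemma rnormB_sqr x y :
  rnorm (x - y) ^+ 2 = rnorm x ^+ 2 + rnorm y ^+ 2 - 2 * complex.Re '<x, y>.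
Proof.
rewrite rnormD_sqr rnormN; congr (_ + _).
by rewrite -mulrN; congr (_ * _); rewrite -[- y]add0r innerBr inner0r sub0r; case: '<_, _>.
Qed.

Lemma parallelogram x y :
  rnorm (x - y) ^+ 2 = 2 * rnorm x ^+ 2 + 2 * rnorm y ^+ 2 - rnorm (x + y) ^+ 2.
Proof. rewrite rnormB_sqr rnormD_sqr; lra. Qed.

Lemma cauchy_schwarz x y : rnorm '<x, y> <= rnorm x * rnorm y.
Proof.
have [->|y0] := eqVneq y 0; first by rewrite inner0r !rnorm0 mulr0.
have ny : 0 < rnorm y by rewrite rnorm_gt0.
set c := '<x, y>; set n := rnorm y.
have := sqr_ge0 (rnorm ((n ^+ 2)%:C *: x - c *: y)).
rewrite rnormB_sqr !rnormZ rnormR innerZl innerZr -/c.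
have -> : Num.conj c * c = (rnorm c ^+ 2)%:C.
  by rewrite mulrC -normCK rnormE rmorphXn.
rewrite -rmorphM /= -/n ger0_norm ?sqr_ge0 // => h.
rewrite -(@ler_sqr _ (rnorm c)) ?nnegrE ?rnorm_ge0 ?mulr_ge0 ?rnorm_ge0 //.
have n2 : 0 < n ^+ 2 by rewrite exprn_gt0.
by rewrite -(ler_pM2l n2) -/n; move: h; rewrite !exprMn; lra.
Qed.

(* The representing vector minimises [|x|^2 - 2 Re (g x)]; the parallelogram
   law makes the almost-minimisers a Cauchy family. *)
Lemma riesz_representation (g : H -> R[i]) (C : R) :
  (forall (c : R[i]) x y, g (c *: x + y) = Num.conj c * g x + g y) ->
  (forall x, rnorm (g x) <= C * rnorm x) ->
  exists x, forall y, '<x, y> = g y.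
Proof.
move=> gl gb.
have gZ c x : g (c *: x) = Num.conj c * g x.
  have g0 : g 0 = 0.
    by apply: rnorm0_eq0; apply: le_trans (gb 0) _; rewrite rnorm0 mulr0.
  by rewrite -[c *: x]addr0 gl g0 addr0.
have gD x y : g (x + y) = g x + g y.
  by have := gl 1 x y; rewrite scale1r rmorph1 mul1r.
have gR (t : R) x : complex.Re (g (t%:C *: x)) = t * complex.Re (g x).
  rewrite gZ (CrealP _) ?mul0r //; last by rewrite complex_real.
  by case: (g x) => a b /=; rewrite mul0r subr0.
pose J x := rnorm x ^+ 2 - 2 * complex.Re (g x).
have Jpar x y : rnorm (x - y) ^+ 2 = 2 * J x + 2 * J y - 4 * J ((2^-1)%:C *: (x + y)).
  rewrite parallelogram /J rnormZ rnormR gR gD raddfD /= ger0_norm //; lra.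
have Jlb x : - C ^+ 2 <= J x.
  have h : complex.Re (g x) <= C * rnorm x by apply: le_trans (ler_Re _) (gb x).
  by have := sqr_ge0 (rnorm x - C); rewrite /J; nra.
pose m := inf (range J).
have hi : has_inf (range J).
  by split; [exists (J 0); exists 0 | exists (- C ^+ 2) => _ [x _ <-]].
have mJ x : m <= J x by apply: ge_inf; [case: hi | exists x].
have [|||x hx] := @complete_nested R H (fun e => [set x | J x <= m + e]).
- move=> e e0; have [_ [x _ <-] h] := inf_adherent e0 hi.
  by exists x => /=; apply: ltW.
- by move=> e e' ee x /= h; lra.
- move=> d d0; exists (d ^+ 2 / 4); first by rewrite divr_gt0 ?exprn_gt0.
  move=> x y /= hx hy.
  rewrite -(@ler_sqr _ (rnorm _)) ?nnegrE ?rnorm_ge0 ?(ltW d0) //.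
  by rewrite Jpar; have := mJ ((2^-1)%:C *: (x + y)); lra.
have Jx : J x <= m.
  rewrite leNgt; apply/negP => mx.
  (* For [y] within distance 1 of [x], [J x - J y] is at most [B] times the distance: [2 |x| + 1]
     comes from the squared norm and [2 |C|] from [g]. So near-minimisers close to [x] force
     [J x <= m]. *)
  pose e := J x - m; pose B := 2 * rnorm x + 2 * `|C| + 1.
  have B0 : 0 < B by rewrite /B; have := rnorm_ge0 x; have := normr_ge0 C; lra.
  have e0 : 0 < e by rewrite subr_gt0.
  have [||y /= Jy hy] := hx (e / 4) (Num.min 1 (e / (4 * B))).
  - by rewrite divr_gt0.
  - by rewrite lt_min ltr01 divr_gt0 // mulr_gt0.
  move: hy; rewrite le_min => /andP[hy1 hy2].
  have h1 : complex.Re (g (y - x)) <= `|C| * rnorm (x - y).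
    apply: le_trans (ler_Re _) _; apply: le_trans (gb _) _; rewrite rnormBC.
    by apply: ler_wpM2r (ler_norm C); apply: rnorm_ge0.
  have h2 : rnorm x <= rnorm (x - y) + rnorm y by rewrite -{1}(subrK y x) rnormD.
  have h2' : rnorm y <= rnorm (x - y) + rnorm x.
    by rewrite rnormBC -{1}(subrK x y) rnormD.
  have gBC : complex.Re (g (y - x)) = complex.Re (g y) - complex.Re (g x).
    by rewrite -[y - x]/(y + - x) gD -scaleN1r gZ rmorphN1 mulN1r raddfD raddfN.
  have h3 : rnorm (x - y) * B <= e / 4.
    apply: le_trans (_ : e / (4 * B) * B <= _); first by rewrite ler_wpM2r // ltW.
    by rewrite invfM mulrA mulfVK // lt0r_neq0.
  have : J x - J y <= rnorm (x - y) * B.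
    rewrite /J /B; set d := rnorm (x - y) in h1 h2 h2' hy1 *.
    have d0 : 0 <= d by apply: rnorm_ge0.
    have : rnorm x ^+ 2 - rnorm y ^+ 2 <= d * (2 * rnorm x + 1).
      have := rnorm_ge0 x; have := rnorm_ge0 y; nra.
    by move: h1; rewrite gBC; nra.
  by rewrite /e in Jy h3 *; lra.
have var y : complex.Re '<x, y> = complex.Re (g y).
  have key t : 0 <= t ^+ 2 * rnorm y ^+ 2 + 2 * t * (complex.Re '<x, y> - complex.Re (g y)).
    have := le_trans Jx (mJ (x + t%:C *: y)).
    rewrite /J rnormD_sqr rnormZ rnormR gD raddfD /= gR innerZr (CrealP _) ?complex_real //.
    have -> : complex.Re (t%:C * '<x, y>) = t * complex.Re '<x, y>.
      by case: '<x, y> => a b /=; rewrite mul0r subr0.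
    by rewrite exprMn real_normK ?num_real //; lra.
  set D := _ - _ in key; suff : D = 0 by rewrite /D; lra.
  apply/eqP; apply: contraT => D0.
  have D2 : 0 < D ^+ 2 by rewrite exprn_even_gt0.
  (* At [t = - D / q] the quadratic in [key] is a negative multiple of [D ^+ 2]. The [+ 1] keeps [q]
     invertible when [y = 0]. *)
  pose q := rnorm y ^+ 2 + 1; have q0 : 0 < q by rewrite /q; have := sqr_ge0 (rnorm y); lra.
  have := key (- D / q); rewrite -(pmulr_rge0 _ (exprn_gt0 2 q0)).
  have -> : q ^+ 2 * ((- D / q) ^+ 2 * rnorm y ^+ 2 + 2 * (- D / q) * D) =
     D ^+ 2 * (rnorm y ^+ 2 - 2 * q) by field; rewrite lt0r_neq0.
  rewrite pmulr_rge0 // /q; have := sqr_ge0 (rnorm y); lra.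
exists x => y; apply/eqP; rewrite eq_complex var eqxx /=; apply/eqP.
have := var ('i *: y); rewrite gZ innerZr conjCi.
by case: '<x, y> => a b; case: (g y) => a' b' /=; lra.
Qed.

Lemma rieszP (g : H -> R[i]) (C : R) :
  (forall (c : R[i]) x y, g (c *: x + y) = Num.conj c * g x + g y) ->
  (forall x, rnorm (g x) <= C * rnorm x) ->
  forall y, '<riesz g, y> = g y.
Proof.
move=> gl gb; have [x hx] := riesz_representation gl gb.
exact: (@xgetPex _ 0 [set x | forall y, '<x, y> = g y] (ex_intro _ x hx)).
Qed.

End HilbertSpace.

(** * Unital C*-algebras as rings *)

Section CStarBasics.
Context {R : realType} (A : cstarType R).
Implicit Types a b c x y : A.

Lemma cmulDl a b c : cmul (a + b) c = cmul a c + cmul b c.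
Proof. by have := cmul_linearl c 1 a b; rewrite !scale1r. Qed.

Lemma cmulDr a b c : cmul c (a + b) = cmul c a + cmul c b.
Proof. by have := cmul_linearr c 1 a b; rewrite !scale1r. Qed.

Lemma cmul0l c : cmul 0 c = 0.
Proof. by have := cmul_linearl c (-1) 0 0; rewrite !scaleN1r !addNr. Qed.

Lemma cmul0r c : cmul c 0 = 0.
Proof. by have := cmul_linearr c (-1) 0 0; rewrite !scaleN1r !addNr. Qed.

Lemma cmulZl (k : R[i]) a c : cmul (k *: a) c = k *: cmul a c.
Proof. by have := cmul_linearl c k a 0; rewrite !addr0 cmul0l addr0. Qed.

Lemma cmulZr (k : R[i]) a c : cmul c (k *: a) = k *: cmul c a.
Proof. by have := cmul_linearr c k a 0; rewrite !addr0 cmul0r addr0. Qed.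

Lemma adj0 : adj (0 : A) = 0.
Proof. by apply: (addrI (adj 0)); rewrite -adjD !addr0. Qed.

Lemma adjN a : adj (- a) = - adj a.
Proof. by apply: (addrI (adj a)); rewrite -adjD !subrr adj0. Qed.

Lemma adjB a b : adj (a - b) = adj a - adj b.
Proof. by rewrite adjD adjN. Qed.

Lemma rnorm_cmul a b : rnorm (cmul a b) <= rnorm a * rnorm b.
Proof. by have := cstar_normM a b; rewrite !rnormE -rmorphM lecR. Qed.

Lemma rnorm_cstar a : rnorm (cmul (adj a) a) = rnorm a ^+ 2.
Proof. by have := cstar_normE a; rewrite !rnormE -rmorphXn => -[]. Qed.

Lemma rnorm_adj a : rnorm (adj a) = rnorm a.
Proof.
have le_adj b : rnorm b <= rnorm (adj b).
  have [->|b0] := eqVneq b 0; first by rewrite rnorm0 rnorm_ge0.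
  have nb : 0 < rnorm b by rewrite rnorm_gt0.
  by rewrite -(ler_pM2r nb) -expr2 -rnorm_cstar rnorm_cmul.
by apply/eqP; rewrite eq_le le_adj -{2}[a]adjK le_adj.
Qed.

End CStarBasics.

Definition is_unity (R : realType) (A : cstarType R) (e : A) : Prop :=
  [/\ e != 0, left_id e cmul & right_id e cmul].

(* An alias of [A] carrying a ring structure; it records the unit [e] and its
   proof so that the structure can be inferred. *)
Definition ualg (R : realType) (A : cstarType R) (e : A) (he : is_unity e) : Type := A.

Section UnitalInstances.
Variables (R : realType) (A : cstarType R) (e : A) (he : is_unity e).
Local Notation U := (ualg he).

HB.instance Definition _ := CStarAlgebra.copy U A.

Let mul1 : left_id (e : U) cmul. Proof. by case: he. Qed.
Let mulr1 : right_id (e : U) cmul. Proof. by case: he. Qed.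
Let one0 : (e : U) != 0. Proof. by case: he. Qed.
Let mulDl : left_distributive (@cmul R U) +%R.
Proof. by move=> a b c; apply: cmulDl. Qed.
Let mulDr : right_distributive (@cmul R U) +%R.
Proof. by move=> a b c; apply: cmulDr. Qed.

HB.instance Definition _ := GRing.Zmodule_isNzRing.Build U
  (@cmulA R U) mul1 mulr1 mulDl mulDr one0.

Let scaleAl (k : R[i]) (a b : U) : k *: (a * b) = (k *: a) * b.
Proof. by rewrite -[RHS]/(cmul _ _) cmulZl. Qed.
HB.instance Definition _ := GRing.Lmodule_isLalgebra.Build R[i] U scaleAl.

Let scaleAr (k : R[i]) (a b : U) : k *: (a * b) = a * (k *: b).
Proof. by rewrite -[RHS]/(cmul _ _) cmulZr. Qed.
HB.instance Definition _ := GRing.Lalgebra_isAlgebra.Build R[i] U scaleAr.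

End UnitalInstances.

(** * Square roots *)

Section UnitalTheory.
Context {R : realType} {A : cstarType R} {e : A} (he : is_unity e).
Local Notation U := (ualg he).
Implicit Types (a b c h x y z : U) (s t : R).

Lemma rnorm_mul a b : rnorm (a * b) <= rnorm a * rnorm b.
Proof. exact: rnorm_cmul. Qed.

Lemma adj_mul a b : adj (a * b) = adj b * adj a.
Proof. exact: adjM. Qed.

Lemma adj_one : adj (1 : U) = 1.
Proof. by rewrite -[LHS]mulr1 -[X in _ * X]adjK -adj_mul mulr1 adjK. Qed.

Lemma rnorm_one : rnorm (1 : U) = 1.
Proof.
have := rnorm_cstar (1 : U); rewrite adj_one -[cmul _ _]/((1 : U) * 1) mulr1.
have h0 : rnorm (1 : U) != 0 by rewrite lt0r_neq0 // rnorm_gt0 oner_neq0.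
by move=> h1; apply: (mulIf h0); rewrite mul1r -expr2.
Qed.

Lemma adj_scale t (x : U) : adj (t%:C *: x) = t%:C *: adj x.
Proof. by rewrite Defs.adjZ (CrealP _) // complex_real. Qed.

Lemma rnorm_scale t (x : U) : rnorm (t%:C *: x) = `|t| * rnorm x.
Proof. by rewrite rnormZ rnormR. Qed.

Lemma rnorm_sqr_sa h : adj h = h -> rnorm (h * h) = rnorm h ^+ 2.
Proof. by move=> hh; rewrite -rnorm_cstar hh. Qed.

Section Sqrt.
Variable y : U.
Hypotheses (ysa : adj y = y) (y1 : rnorm y < 1).

(** [r] is the radius of a ball that [G] maps into itself, and also a Lipschitz constant of [G] on
    it. [S s] collects points that [G] moves by at most [s]; it carries self-adjointness and
    commutation along so that the limit inherits them. *)
Let r := (1 + rnorm y) / 2.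
Let G z : U := (2^-1)%:C *: (y + z * z).
Let S s : set U := [set z | [/\ adj z = z, forall b, GRing.comm b y -> GRing.comm b z,
  rnorm z <= r & rnorm (z - G z) <= s]].

Let r01 : 0 <= r < 1.
Proof. by rewrite /r; have := rnorm_ge0 y; move: y1; lra. Qed.

Let G_lip z w : rnorm z <= r -> rnorm w <= r -> rnorm (G z - G w) <= r * rnorm (z - w).
Proof.
move=> zr wr; have -> : G z - G w = (2^-1)%:C *: (z * (z - w) + (z - w) * w).
  by rewrite /G -scalerBr mulrBr mulrBl addrA subrK opprD addrACA subrr add0r.
rewrite rnorm_scale ger0_norm; last lra.
have h1 := rnorm_mul z (z - w); have h2 := rnorm_mul (z - w) w.
have := rnormD (z * (z - w)) ((z - w) * w); have := rnorm_ge0 (z - w).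
set d := rnorm (z - w) in h1 h2 *; move=> d0 h3.
have : rnorm z * d <= r * d by rewrite ler_wpM2r.
have : d * rnorm w <= r * d by rewrite mulrC ler_wpM2r.
lra.
Qed.

Let G_stable s z : S s z -> S (r * s) (G z).
Proof.
move=> [za zc zr zs]; have [r0 r1] := andP r01.
have Gr : rnorm (G z) <= r.
  rewrite rnorm_scale ger0_norm; last lra.
  have := rnormD y (z * z); have := rnorm_mul z z; have := rnorm_ge0 z.
  rewrite /r in zr *; have := rnorm_ge0 y; move: y1 zr.
  set n := rnorm y; set m := rnorm z; nra.
split => //.
- by rewrite adj_scale adjD adj_mul ysa za.
- move=> b by_; rewrite /GRing.comm /G -scalerAr -scalerAl mulrDr mulrDl by_.
  by rewrite mulrA (zc b by_) -!mulrA (zc b by_).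
- by apply: le_trans (G_lip zr Gr) _; rewrite ler_wpM2l.
Qed.

Let S_ne s : 0 < s -> S s !=set0.
Proof.
move=> s0; have [r0 r1] := andP r01.
have it n : S (r ^+ n) !=set0.
  elim: n => [|n [z zS]]; last by exists (G z); rewrite exprS; apply: G_stable.
  exists 0; split; rewrite ?adj0 ?rnorm0 //.
    by move=> b _; rewrite /GRing.comm mulr0 mul0r.
  rewrite sub0r rnormN /G mulr0 addr0 rnorm_scale expr0 ger0_norm; last lra.
  by move: y1; lra.
have : (r ^+ n @[n --> \oo] --> 0)%R by apply: cvg_expr; rewrite ger0_norm.
move=> /cvgrPdist_lt /(_ s s0) [n _ /(_ n (leqnn n))] /=.
rewrite sub0r normrN ger0_norm ?exprn_ge0 // => rns.
have [z [za zc zr zs]] := it n; exists z; split => //.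
exact: le_trans zs (ltW rns).
Qed.

(** The equation [1 - y = (1 - z)^2] is [z = (y + z^2) / 2], that is [z = G z], and [G] is a
    contraction. Commutation with the commutant of [y] is what later makes products of such roots
    self-adjoint. *)
Lemma sqrt_one_sub : exists z, [/\ adj z = z, 1 - y = (1 - z) * (1 - z)
  & forall b, GRing.comm b y -> GRing.comm b z].
Proof.
have [r0 r1] := andP r01.
have S_diam s z w : S s z -> S s w -> rnorm (z - w) * (1 - r) <= 2 * s.
  move=> [_ _ zr zs] [_ _ wr ws]; have := G_lip zr wr.
  have := rnorm_dist (G z) z w; have := rnorm_dist (G w) (G z) w.
  by move: ws zs; rewrite (rnormBC w (G w)); lra.
have [||x hx] := @complete_nested R U S S_ne.
- by move=> s s' ss z [za zc zr zs]; split => //; apply: le_trans ss.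
- move=> d d0; exists (d * (1 - r) / 2); first by rewrite divr_gt0 // mulr_gt0 // subr_gt0.
  move=> z w zS wS; have := S_diam _ _ _ zS wS.
  have -> : 2 * (d * (1 - r) / 2) = d * (1 - r) by field.
  by rewrite ler_pM2r // subr_gt0.
have xr : rnorm x <= r.
  apply/ler_addgt0Pr => d d0; have [z [_ _ zr _] zx] := hx 1 d ltr01 d0.
  by have := rnormD (x - z) z; rewrite subrK; lra.
have xa : adj x = x.
  apply: rnorm_eq_eps => d d0.
  have [z [za _ _ _] zx] := hx 1 (d / 2) ltr01 (divr_gt0 d0 (ltr0Sn _ 1)).
  have := rnorm_dist z (adj x) x; rewrite -{1}za -adjB rnorm_adj rnormBC.
  by move: zx; rewrite [in rnorm (z - x)]rnormBC; lra.
have xG : x = G x.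
  apply: rnorm_eq_eps => d d0; have d3 : 0 < d / 3 by rewrite divr_gt0.
  have [z [_ _ zr zs] zx] := hx (d / 3) (d / 3) d3 d3.
  have := G_lip zr xr; have := rnorm_dist z x (G x).
  have := rnorm_dist (G z) z (G x); rewrite (rnormBC z x).
  have := rnorm_ge0 (x - z); nra.
exists x; split => //.
  have hx2 : y + x * x = x + x.
    rewrite {3 4}xG /G -scalerDl -rmorphD (_ : 2^-1 + 2^-1 = 1) ?scale1r //.
    by lra.
  by rewrite -[y](addrK (x * x)) hx2 mulrBr mulr1 mulrBl mul1r -[x + x - _]addrA opprD addrA.
move=> b by_; apply: rnorm_eq_eps => d d0.
have d1 : 0 < d / (2 * rnorm b + 1).
  by rewrite divr_gt0 //; have := rnorm_ge0 b; lra.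
have [z [_ zc _ _] zx] := hx 1 _ ltr01 d1.
have -> : b * x - x * b = b * (x - z) - (x - z) * b.
  by rewrite mulrBr mulrBl (zc b by_) opprB addrA subrK.
apply: le_trans (rnormB _ _) _.
have := rnorm_mul b (x - z); have := rnorm_mul (x - z) b.
move: zx; rewrite ler_pdivlMr; first by have := rnorm_ge0 (x - z); nra.
by have := rnorm_ge0 b; lra.
Qed.

End Sqrt.
End UnitalTheory.

(** * The top of the spectrum *)

Lemma bernoulli_le (R : realType) (x : R) (n : nat) :
  0 <= x -> 1 + x *+ n <= (1 + x) ^+ n.
Proof.
move=> x0; elim: n => [|n IH]; first by rewrite mulr0n addr0 expr0.
rewrite exprS mulrS; apply: le_trans (_ : (1 + x) * (1 + x *+ n) <= _).
  rewrite mulrDl mul1r mulrDr mulr1 addrA [1 + x + _]addrAC -!addrA lerD2l lerD2l.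
  by rewrite lerDl mulr_ge0 // mulrn_wge0.
by apply: ler_wpM2l IH; lra.
Qed.

(** If [r = 1 + x] with [x > 0], the square of Bernoulli's bound at [m = 2^(k+1)] contains
    [x^2 m^2], which beats the linear [2 K m] once [m > 2 |K| / x^2]. *)
Lemma sub_exponential_le1 (R : realType) (r K : R) :
  (forall k, r ^+ (2 ^ k) <= 1 + K * (2 ^ k)%:R) -> r <= 1.
Proof.
move=> h; rewrite leNgt; apply/negP => r1.
pose x := r - 1; have x0 : 0 < x by rewrite subr_gt0.
pose k := Num.trunc (2 * `|K| / x ^+ 2).
have kK : 2 * `|K| / x ^+ 2 < k.+1%:R by apply: truncnS_gt.
pose m : R := (2 ^ k.+1)%:R.
have km : k.+1%:R <= m by rewrite ler_nat ltnW // ltn_expl.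
have m0 : 0 < m by rewrite ltr0n expn_gt0.
have := h k.+2; rewrite expnS mulnC exprM natrM -/m.
have hb : (1 + x * m) ^+ 2 <= (r ^+ (2 ^ k.+1)) ^+ 2.
  have := @bernoulli_le R x (2 ^ k.+1) (ltW x0).
  rewrite -mulr_natr (_ : 1 + x = r); last by rewrite /x; lra.
  rewrite -/m => hb; rewrite ler_sqr // nnegrE ?exprn_ge0 //; last lra.
  by have := mulr_ge0 (ltW x0) (ltW m0); lra.
move=> /(le_trans hb) {hb}.
have : 2 * `|K| < x ^+ 2 * m.
  rewrite [_ * m]mulrC -ltr_pdivrMr ?exprn_gt0 //; exact: lt_le_trans km.
have := ler_norm K; have := mulr_gt0 x0 m0; nra.
Qed.

Section UpperBound.
Context {R : realType} {A : cstarType R} {e : A} (he : is_unity e).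
Local Notation U := (ualg he).
Implicit Types (a b c d h x y z w : U) (s t p : R).

Definition rscal t : U := t%:C *: 1.

Lemma rscal_alg t : rscal t = t%:C%:A.
Proof. by []. Qed.

Lemma rscalD s t : rscal (s + t) = rscal s + rscal t.
Proof. by rewrite /rscal rmorphD scalerDl. Qed.

Lemma rscalM s t : rscal (s * t) = rscal s * rscal t.
Proof. by rewrite /rscal rmorphM -scalerAl mul1r scalerA. Qed.

Lemma rscalN t : rscal (- t) = - rscal t.
Proof. by rewrite /rscal rmorphN scaleNr. Qed.

Lemma rscal_comm t x : rscal t * x = x * rscal t.
Proof. by rewrite /rscal -scalerAl -scalerAr mul1r mulr1. Qed.

Lemma rscalE t x : rscal t * x = t%:C *: x.
Proof. by rewrite /rscal -scalerAl mul1r. Qed.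

Lemma adj_rscal t : adj (rscal t) = rscal t.
Proof. by rewrite adj_scale adj_one. Qed.

Lemma rnorm_rscal t : rnorm (rscal t) = `|t|.
Proof. by rewrite rnorm_scale rnorm_one mulr1. Qed.

(* For self-adjoint [h] this is the largest element of the spectrum of [h]. *)
Definition umax h : R := inf [set s | exists t, s = rnorm (rscal t + h) - t].

Lemma umax_has_inf h : has_inf [set s | exists t, s = rnorm (rscal t + h) - t].
Proof.
split; first by exists (rnorm (rscal 0 + h) - 0); exists 0.
exists (- rnorm h) => _ [t ->].
have := rnorm_dist (- h) (rscal t) 0; rewrite !opprK !subr0 rnormN rnorm_rscal.
by have := ler_norm t; lra.
Qed.

Lemma umax_le t h : umax h <= rnorm (rscal t + h) - t.
Proof. by apply: ge_inf; [case: (umax_has_inf h) | exists t]. Qed.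

Lemma umax_lt h s : umax h < s -> exists t, rnorm (rscal t + h) < t + s.
Proof.
move=> hs; have s0 : 0 < s - umax h by rewrite subr_gt0.
have [_ [t ->]] := inf_adherent s0 (umax_has_inf h).
by rewrite -/(umax h) => ht; exists t; lra.
Qed.

Lemma umaxD h x : umax (h + x) <= umax h + umax x.
Proof.
apply/ler_addgt0Pr => d d0.
have [|s hs] := @umax_lt h (umax h + d / 2); first lra.
have [|t xt] := @umax_lt x (umax x + d / 2); first lra.
apply: le_trans (umax_le (s + t) _) _; rewrite rscalD addrACA.
by have := rnormD (rscal s + h) (rscal t + x); lra.
Qed.

Lemma umaxZ_le t h : 0 < t -> umax (t%:C *: h) <= t * umax h.
Proof.
move=> t0; apply/ler_addgt0Pr => d d0.
have [|s hs] := @umax_lt h (umax h + d / t); first by have := divr_gt0 d0 t0; lra.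
apply: le_trans (umax_le (t * s) _) _.
rewrite rscalM rscalE -scalerDr rnorm_scale gtr0_norm //.
move: hs; rewrite -(ltr_pM2l t0) !mulrDr [t * (d / t)]mulrC mulfVK ?lt0r_neq0 //.
lra.
Qed.

Lemma umaxZ t h : 0 < t -> umax (t%:C *: h) = t * umax h.
Proof.
move=> t0; apply/eqP; rewrite eq_le umaxZ_le //=.
have ti : 0 < t^-1 by rewrite invr_gt0.
have := umaxZ_le (t%:C *: h) ti.
rewrite scalerA -rmorphM mulVf ?lt0r_neq0 // scale1r.
by rewrite -(ler_pM2l t0) mulrA divff ?lt0r_neq0 // mul1r.
Qed.

Lemma umax_rscal s : umax (rscal s) <= s.
Proof.
by apply: le_trans (umax_le (- s) _) _; rewrite rscalN addNr rnorm0 sub0r opprK.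
Qed.

(** If [|t + h| < T = t + s], then [y = (t + h) / T] has norm below 1 and [s - h = T (1 - y)], so
    the root is a rescaled [1 - z]. *)
Lemma sqrt_above h s : adj h = h -> umax h < s ->
  exists d, [/\ adj d = d, rscal s - h = d * d & forall b, GRing.comm b h -> GRing.comm b d].
Proof.
move=> hsa /umax_lt[t ht]; have T0 : 0 < t + s.
  exact: le_lt_trans (rnorm_ge0 _) ht.
set T := t + s in ht T0; pose y : U := (T^-1)%:C *: (rscal t + h).
have [||z [za zy zc]] := @sqrt_one_sub _ _ _ he y.
- by rewrite adj_scale adjD adj_rscal hsa.
- by rewrite rnorm_scale gtr0_norm ?invr_gt0 // mulrC ltr_pdivrMr // mul1r.
exists ((Num.sqrt T)%:C *: (1 - z)); split.
- by rewrite adj_scale adjB adj_one za.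
- rewrite -scalerAl -scalerAr scalerA -rmorphM -expr2 sqr_sqrtr ?(ltW T0) // -zy.
  rewrite scalerBr scalerA -rmorphM divff ?lt0r_neq0 // scale1r -/(rscal T) rscalD.
  by rewrite opprD addrA [rscal t + _]addrC addrK.
- move=> b bh; rewrite /GRing.comm -scalerAr -scalerAl mulrBr mulrBl mulr1 mul1r zc //.
  rewrite /GRing.comm /y -scalerAr -scalerAl mulrDr mulrDl bh.
  by rewrite rscal_comm.
Qed.

(** What is needed is [|t^2 - h^2| <= t^2]. Take a root [d] of [t^2 - h^2] commuting with [h] and
    put [u = h + i d]. Then [u^* u = h^2 + d^2 = t^2], so [|u| = t]; as the imaginary part of [u],
    [d] has norm at most [t], and [|d^2| <= t^2]. *)
Lemma umax_opp_sqr h : adj h = h -> umax (- (h * h)) <= 0.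
Proof.
move=> hsa; pose t := rnorm h + 1; have h0 := rnorm_ge0 h.
have t0 : 0 < t by rewrite /t; lra.
have hhsa : adj (h * h) = h * h by rewrite adj_mul hsa.
have [|d [da dd dc]] := @sqrt_above (h * h) (t ^+ 2) hhsa.
  apply: le_lt_trans (umax_le 0 _) _.
  rewrite /rscal scale0r add0r subr0 rnorm_sqr_sa // /t; nra.
have hd : h * d = d * h by apply: dc; rewrite /GRing.comm mulrA.
pose u : U := h + 'i *: d.
have ua : adj u = h - 'i *: d.
  by rewrite adjD hsa Defs.adjZ da conjCi scaleNr.
have ii : ('i : R[i]) * 'i = - 1 by rewrite -expr2 sqrCi.
have un : rnorm u = t.
  apply/eqP; rewrite -(@eqrXn2 _ 2) ?rnorm_ge0 ?(ltW t0) //.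
  rewrite -rnorm_cstar ua -[cmul _ _]/((h - 'i *: d) * (h + 'i *: d)).
  rewrite mulrDr !mulrBl -!scalerAl -!scalerAr hd addrA subrK scalerA ii.
  by rewrite scaleN1r opprK -dd addrC subrK rnorm_rscal ger0_norm ?sqr_ge0.
have dn : rnorm d <= t.
  have := rnormB u (adj u); rewrite rnorm_adj un ua opprB addrC addrA subrK.
  rewrite -scalerDl rnormZ (_ : 'i + 'i = 'i * 2%:C); last by rewrite rmorphD mulrDr mulr1.
  by rewrite rnormM rnormi rnormR mul1r ger0_norm //; lra.
apply: le_trans (umax_le (t ^+ 2) _) _; rewrite dd rnorm_sqr_sa //.
by have := rnorm_ge0 d; nra.
Qed.

Lemma exp_shift t c n : 0 <= t -> exists q : U,
  (rscal t + c * adj c) ^+ n = rscal (t ^+ n) + c * q * adj c /\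
  rnorm q * Num.max t (rnorm (rscal t + adj c * c)) <=
    n%:R * Num.max t (rnorm (rscal t + adj c * c)) ^+ n.
Proof.
move=> t0; set s := Num.max _ _.
have ts : t <= s by rewrite le_max lexx.
have s0 := le_trans t0 ts.
have cs : rnorm (rscal t + adj c * c) <= s by rewrite le_max lexx orbT.
elim: n => [|n [q [IH qn]]].
  by exists 0; rewrite mulr0 !mul0r addr0 rnorm0 !mul0r !expr0 /rscal scale1r.
exists (rscal (t ^+ n) + (rscal t + adj c * c) * q); split.
  rewrite exprS IH exprS mulrDl !mulrDr !mulrDl -rscalM -!addrA; congr (_ + _).
  rewrite [c * (_ + _)]mulrDr [in RHS]mulrDl addrCA !mulrA; congr (_ + (_ + _)).
    by rewrite -[LHS]mulrA -rscal_comm mulrA.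
  by rewrite rscal_comm.
rewrite exprS; have tn : t ^+ n <= s ^+ n by rewrite lerXn2r ?nnegrE.
have h1 : rnorm (rscal (t ^+ n) + (rscal t + adj c * c) * q) <= s ^+ n + s * rnorm q.
  apply: le_trans (rnormD _ _) _; apply: lerD.
    by rewrite rnorm_rscal ger0_norm ?exprn_ge0.
  by apply: le_trans (rnorm_mul _ _) _; rewrite ler_wpM2r // rnorm_ge0.
apply: le_trans (ler_wpM2r s0 h1) _.
rewrite mulrDl -mulrA -natr1 mulrDl mul1r [s ^+ n * s]mulrC addrC lerD2r.
by rewrite [leRHS]mulrCA ler_wpM2l.
Qed.

Lemma rnorm_exp2 h k : adj h = h -> rnorm (h ^+ (2 ^ k)) = rnorm h ^+ (2 ^ k).
Proof.
move=> hsa; have expsa n : adj (h ^+ n) = h ^+ n.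
  elim: n => [|n IH]; first by rewrite !expr0 adj_one.
  by rewrite exprS adj_mul IH hsa -exprSr exprS.
elim: k => [|k IH]; first by rewrite !expr1.
by rewrite expnS mulnC exprM expr2 rnorm_sqr_sa // IH -exprM.
Qed.

(* [c c^*] and [c^* c] have the same spectrum up to 0. *)
Lemma umax_swap c : umax (c * adj c) <= Num.max (umax (adj c * c)) 0.
Proof.
have swap t : 0 < t ->
    rnorm (rscal t + c * adj c) <= Num.max t (rnorm (rscal t + adj c * c)).
  move=> t0; set s := Num.max _ _; set w := _ + _.
  have ts : t <= s by rewrite le_max lexx.
  have s0 := lt_le_trans t0 ts.
  have wsa : adj w = w by rewrite adjD adj_rscal adj_mul adjK.
  rewrite -[s]mul1r -ler_pdivrMr //.
  (* Apart from [t^n], the power [w^n] is [c q c^*] with [q] of norm at most [n s^n / s]. This gives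
     [|w^n| <= s^n (1 + n |c|^2 / s)], and for [n = 2^k] the left side equals [|w|^n]. *)
  apply: (@sub_exponential_le1 R _ (rnorm c ^+ 2 / s)) => k.
  have [q [wq qn]] := @exp_shift t c (2 ^ k) (ltW t0); rewrite -/w in wq.
  rewrite expr_div_n -(rnorm_exp2 _ wsa) wq ler_pdivrMr ?exprn_gt0 //.
  apply: le_trans (rnormD _ _) _; rewrite mulrDl mul1r; apply: lerD.
    by rewrite rnorm_rscal ger0_norm ?exprn_ge0 ?(ltW t0) // lerXn2r // nnegrE ltW.
  apply: le_trans (rnorm_mul _ _) _; rewrite rnorm_adj.
  have h1 := ler_wpM2r (rnorm_ge0 c) (rnorm_mul c q).
  apply: le_trans h1 _.
  have -> : rnorm c * rnorm q * rnorm c = rnorm c ^+ 2 * rnorm q by ring.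
  rewrite -[_ / s * _ * _]mulrA -[_ / s * _]mulrA ler_wpM2l ?sqr_ge0 //.
  by rewrite [leRHS]mulrC ler_pdivlMr.
apply/ler_addgt0Pr => d d0; set m := Num.max _ _.
have cm : umax (adj c * c) <= m by rewrite le_max lexx.
have m0 : 0 <= m by rewrite le_max lexx orbT.
have [|t ct] := @umax_lt (adj c * c) (m + d); first lra.
(* [swap] needs a positive parameter. Enlarging [t] never increases [|t + h| - t], so [t'] is as
   good as [t]. The bare [t'] in the maximum of [swap] is the origin of the 0 in the statement. *)
pose t' := Num.max t 1.
have t'0 : 0 < t' by rewrite lt_max ltr01 orbT.
have tt' : t <= t' by rewrite le_max lexx.
apply: le_trans (umax_le t' _) _; rewrite lerBlDl.
apply: le_trans (swap t' t'0) _; rewrite ge_max; apply/andP; split; first lra.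
have -> : rscal t' + adj c * c = rscal (t' - t) + (rscal t + adj c * c).
  by rewrite addrA -rscalD subrK.
apply: le_trans (rnormD _ _) _; rewrite rnorm_rscal ger0_norm; lra.
Qed.

End UpperBound.

(** * Positivity of a^* a *)

Section GramPositive.
Context {R : realType} {A : cstarType R} {e : A} (he : is_unity e).
Local Notation U := (ualg he).
Local Notation rscal := (rscal he).
Implicit Types (a b c d h x y z w : U) (s t p q : R).

Lemma adj_comm_mul_sa h x : adj h = h -> adj x = x -> h * x = x * h -> adj (h * x) = h * x.
Proof. by move=> hsa xsa hx; rewrite adj_mul hsa xsa. Qed.

(* If [c = x + iy] then [c^* c + c c^* = 2 (x^2 + y^2)], so [- c^* c <= c c^*]. *)
Lemma umax_opp_gram_le c : umax (- (adj c * c)) <= Num.max (umax (adj c * c)) 0.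
Proof.
pose x := c + adj c; pose y : U := 'i *: (c - adj c).
have xa : adj x = x by rewrite adjD adjK addrC.
have ya : adj y = y by rewrite Defs.adjZ conjCi adjB adjK scaleNr -scalerN opprB.
have id : - (adj c * c) =
    c * adj c + ((2^-1)%:C *: - (x * x) + (2^-1)%:C *: - (y * y)).
  rewrite -scalerDr -opprD.
  have -> : x * x + y * y = (adj c * c + c * adj c) + (adj c * c + c * adj c).
    have ii : ('i : R[i]) * 'i = - 1 by rewrite -expr2 sqrCi.
    rewrite /y -scalerAl -scalerAr scalerA ii scaleN1r mulrDr !mulrDl !mulrDr.
    rewrite !(mulNr, mulrN) !opprD !opprK.
    move: (c * c) (adj c * c) (c * adj c) (adj c * adj c) => P T S Q.
    rewrite -!addrA ![_ + (T + _)]addrCA ![_ + (S + _)]addrCA.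
    rewrite -opprD [P + _]addrA subrr addr0 [RHS]addrCA; congr (_ + _).
    by rewrite addrCA (addrC S T).
  rewrite scalerN scalerDr -scalerDl -rmorphD (_ : 2^-1 + 2^-1 = 1); last lra.
  by rewrite scale1r opprD addrC addrNK.
have half h : adj h = h -> umax ((2^-1)%:C *: - (h * h)) <= 0.
  move=> ha; rewrite umaxZ; last by rewrite invr_gt0.
  by have := umax_opp_sqr ha; lra.
rewrite id; apply: le_trans (umaxD _ _) _.
have := umaxD ((2^-1)%:C *: - (x * x)) ((2^-1)%:C *: - (y * y)).
by have := half _ xa; have := half _ ya; have := umax_swap c; lra.
Qed.

(** The number [4 q^3] is the value of [x (3 q - x)^2] at its critical point [x = q]; hence the
    double root there. The factor [4 q - x] stays positive for [x <= 3 q]. *)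
Lemma cubic_above q b :
  rscal (4 * q ^+ 3) - (rscal (3 * q) - b) * b * (rscal (3 * q) - b) =
  (rscal (4 * q) - b) * ((b - rscal q) * (b - rscal q)).
Proof.
(* The identity involves only [b] and scalars, so it is checked by [ring] on polynomials and
   evaluated at [b], the algebra itself being noncommutative. *)
have /(congr1 (horner_alg b)) :
    (4 * q%:C ^+ 3)%:P - ((3 * q%:C)%:P - 'X) * 'X * ((3 * q%:C)%:P - 'X) =
    ((4 * q%:C)%:P - 'X) * (('X - (q%:C)%:P) * ('X - (q%:C)%:P)).
  by ring.
rewrite !(rmorphB (horner_alg b), rmorphM (horner_alg b)) /= !horner_algX !horner_algC.
by rewrite !rscal_alg !(rmorphM (real_complex R)) !rmorph_nat.
Qed.

(** For [x <= 0] the correction [(6 q - x) x^2] is nonnegative, so [x (3 q - x)^2 <= 9 q^2 x]: the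
    negative spectrum is stretched by at least [9 q^2]. *)
Lemma cubic_below q b :
  - (rscal (9 * q ^+ 2) * b) =
  - ((rscal (3 * q) - b) * b * (rscal (3 * q) - b)) - (rscal (6 * q) - b) * (b * b).
Proof.
have /(congr1 (horner_alg b)) :
    - ((9 * q%:C ^+ 2)%:P * 'X) =
    - (((3 * q%:C)%:P - 'X) * 'X * ((3 * q%:C)%:P - 'X)) -
      ((6 * q%:C)%:P - 'X) * ('X * 'X).
  by ring.
rewrite !(rmorphB (horner_alg b), rmorphN (horner_alg b), rmorphM (horner_alg b)) /=.
rewrite !horner_algX !horner_algC.
by rewrite !rscal_alg !(rmorphM (real_complex R)) !rmorph_nat.
Qed.

(** A root [d] of [s - h] commutes with [x], so the product is the square of the self-adjoint
    element [d x]. *)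
Lemma umax_opp_prod h s x : adj h = h -> umax h < s -> adj x = x -> h * x = x * h ->
  umax (- ((rscal s - h) * (x * x))) <= 0.
Proof.
move=> ha hs xa hx; have [d [da -> dc]] := sqrt_above ha hs.
have dx : x * d = d * x by apply: dc.
have -> : d * d * (x * x) = (d * x) * (d * x).
  by rewrite -!mulrA; congr (_ * _); rewrite !mulrA dx.
by apply/umax_opp_sqr/adj_comm_mul_sa.
Qed.

(* With [b = c^* c] and [p = umax b], replacing [c] by [c (p - b)] multiplies
   the ratio [umax (- b) / umax b] by at least 27/4. *)
Lemma umax_opp_gram_ratio n c :
  6 ^+ n * umax (- (adj c * c)) <= Num.max (umax (adj c * c)) 0.
Proof.
elim: n c => [|n IH] c; first by rewrite expr0 mul1r umax_opp_gram_le.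
set b := adj c * c; have [m0|m0] := leP (umax (- b)) 0.
  apply: (@le_trans _ _ 0); last by rewrite le_max lexx orbT.
  by rewrite mulr_ge0_le0 // exprn_ge0.
have p0 : 0 < umax b.
  have := lt_le_trans m0 (umax_opp_gram_le c); rewrite -/b lt_max ltxx orbF //.
pose q := umax b / 3; have q0 : 0 < q by rewrite divr_gt0.
have pq : umax b = 3 * q by rewrite /q; lra.
have ba : adj b = b by rewrite adj_mul adjK.
have bs : adj (rscal (3 * q) - b) = rscal (3 * q) - b by rewrite adjB adj_rscal ba.
pose Q := (rscal (3 * q) - b) * b * (rscal (3 * q) - b).
have hQ : adj (c * (rscal (3 * q) - b)) * (c * (rscal (3 * q) - b)) = Q.
  by rewrite adj_mul bs /Q /b !mulrA.
have := IH (c * (rscal (3 * q) - b)); rewrite hQ => IHQ.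
have Qup : umax Q <= 4 * q ^+ 3.
  have -> : Q = rscal (4 * q ^+ 3) + - (rscal (4 * q ^+ 3) - Q).
    by rewrite opprB addrC subrK.
  apply: le_trans (umaxD _ _) _; have := @umax_rscal _ _ _ he (4 * q ^+ 3).
  rewrite cubic_above => h1.
  have := @umax_opp_prod b (4 * q) (b - rscal q) ba.
  rewrite pq adjB ba adj_rscal mulrBr mulrBl rscal_comm => h2.
  by have := h2 _ erefl erefl; lra.
have Qlow : 9 * q ^+ 2 * umax (- b) <= umax (- Q).
  rewrite -umaxZ; last by rewrite mulr_gt0 // exprn_gt0.
  rewrite -rscalE mulrN cubic_below -/Q; apply: le_trans (umaxD _ _) _.
  have := @umax_opp_prod b (6 * q) b ba; rewrite pq => h2.
  by have := h2 _ ba erefl; lra.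
have h6 : 0 <= (6 : R) ^+ n by apply: exprn_ge0.
have h1 : 6 ^+ n * (9 * q ^+ 2 * umax (- b)) <= 4 * q ^+ 3.
  apply: le_trans (ler_wpM2l h6 Qlow) _; apply: le_trans IHQ _.
  by rewrite ge_max Qup /= mulr_ge0 // exprn_ge0 // ltW.
(* Rounding the factor [27/4] down to 6 leaves slack: [6 * 4 / 9 = 8/3 <= 3]. *)
rewrite le_max; apply/orP; left; rewrite pq exprS.
have q2 : 0 < q ^+ 2 by rewrite exprn_gt0.
rewrite -(ler_pM2l q2); move: h1 (ltW q0) (ltW q2); nra.
Qed.

Lemma umax_opp_gram c : umax (- (adj c * c)) <= 0.
Proof.
rewrite leNgt; apply/negP; set m := umax _ => m0; set p := Num.max (umax (adj c * c)) 0.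
have h n : 6 ^+ n * m <= p by apply: umax_opp_gram_ratio.
pose n := Num.trunc (p / m); have hn : p / m < n.+1%:R by apply: truncnS_gt.
have : n.+1%:R <= (6 : R) ^+ n.+1 by rewrite -natrX ler_nat ltnW // ltn_expl.
move: hn; rewrite ltr_pdivrMr // => hn h6.
by have := h n.+1; have := ler_wpM2r (ltW m0) h6; lra.
Qed.

End GramPositive.

(** * The Hahn-Banach theorem *)

Section HahnBanach.
Context {R : realType} {V : lmodType R[i]}.
Implicit Types (p q : V -> R) (x y : V) (t : R).

Definition sublinear q : Prop :=
  (forall x y, q (x + y) <= q x + q y) /\
  (forall t x, 0 < t -> q (t%:C *: x) <= t * q x).

Lemma sublinear0 q : sublinear q -> q 0 = 0.
Proof.
move=> [qD qZ]; have := qD 0 0; have := qZ (2^-1) 0.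
by rewrite invr_gt0 ltr0n scaler0 addr0 => /(_ isT) h1 h2; lra.
Qed.

Lemma sublinear_opp q x : sublinear q -> - q (- x) <= q x.
Proof.
by move=> sq; have := sq.1 x (- x); rewrite subrr (sublinear0 sq); lra.
Qed.

Lemma sublinearZ q t x : sublinear q -> 0 < t -> q (t%:C *: x) = t * q x.
Proof.
move=> sq t0; apply/eqP; rewrite eq_le sq.2 //=.
have := sq.2 t^-1 (t%:C *: x); rewrite invr_gt0 t0 => /(_ isT).
rewrite scalerA -rmorphM mulVf ?lt0r_neq0 // scale1r.
by rewrite -(ler_pM2l t0) mulrA divff ?lt0r_neq0 // mul1r.
Qed.

Section Shift.
Variables (q : V -> R) (x : V).
Hypothesis sq : sublinear q.

Let D y := [set s | exists2 t : R, 0 <= t & s = q (y + t%:C *: x) - t * q x].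

(** The standard perturbation in the minimality proof of Hahn-Banach: it is sublinear, lies below
    [q], and is at most [q (y + x) - q x] at [y]. If [q] is minimal it equals [q], which is the
    missing half of additivity. *)
Definition shift y : R := inf (D y).

Let D_has_inf y : has_inf (D y).
Proof.
split; first by exists (q (y + 0%:C *: x) - 0 * q x); exists 0.
exists (- q (- y)) => _ [t t0 ->].
have := sq.1 (y + t%:C *: x) (- y); rewrite addrC addKr.
have [->|tn] := eqVneq t 0; first by rewrite scale0r addr0 (sublinear0 sq); lra.
by rewrite (sublinearZ _ sq) ?lt0r ?tn //; lra.
Qed.

Lemma shift_le y t : 0 <= t -> shift y <= q (y + t%:C *: x) - t * q x.
Proof. by move=> t0; apply: ge_inf; [case: (D_has_inf y) | exists t]. Qed.

Lemma shift_lt y s : shift y < s -> exists2 t : R, 0 <= t & q (y + t%:C *: x) - t * q x < s.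
Proof.
move=> hs; have s0 : 0 < s - shift y by rewrite subr_gt0.
have [_ [t t0 ->] h] := inf_adherent s0 (D_has_inf y).
by exists t => //; move: h; rewrite -/(shift y); lra.
Qed.

Lemma shift_le_id y : shift y <= q y.
Proof.
by have := shift_le y (lexx 0); rewrite scale0r addr0 mul0r subr0.
Qed.

Lemma sublinear_shift : sublinear shift.
Proof.
split.
  move=> y z; apply/ler_addgt0Pr => d d0.
  have [|s s0 ys] := @shift_lt y (shift y + d / 2); first lra.
  have [|t t0 zt] := @shift_lt z (shift z + d / 2); first lra.
  apply: le_trans (shift_le _ (addr_ge0 s0 t0)) _.
  have := sq.1 (y + s%:C *: x) (z + t%:C *: x).
  by rewrite addrACA -scalerDl -rmorphD; lra.
move=> l y l0; apply/ler_addgt0Pr => d d0.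
have [|t t0 yt] := @shift_lt y (shift y + d / l); first by have := divr_gt0 d0 l0; lra.
have lt0 : 0 <= l * t by rewrite mulr_ge0 // ltW.
apply: le_trans (shift_le _ lt0) _.
rewrite rmorphM -scalerA -scalerDr (sublinearZ _ sq) //.
move: yt; rewrite -(ltr_pM2l l0) mulrBr mulrDr [l * (d / l)]mulrC mulfVK ?lt0r_neq0 //.
by lra.
Qed.
End Shift.

(** Comparability is used twice: it gives the lower bound [- q0 (- x)] common to all members, and it
    lets one member, the smaller of two, be nearly optimal at both [x] and [y]. *)
Lemma sublinear_chain_inf (p : V -> R) (C : set (V -> R)) :
  C !=set0 -> (forall q, C q -> sublinear q) ->
  (forall q q', C q -> C q' -> (forall x, q x <= q' x) \/ (forall x, q' x <= q x)) ->
  sublinear (fun x => inf [set q x | q in C]) /\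
  forall q x, C q -> inf [set q x | q in C] <= q x.
Proof.
move=> [q0 Cq0] Csub Ctot.
have hi x : has_inf [set q x | q in C].
  split; first by exists (q0 x); exists q0.
  exists (- q0 (- x)) => _ [q Cq <-].
  have := sublinear_opp x (Csub _ Cq); have := sublinear_opp x (Csub _ Cq0).
  by case: (Ctot q q0 Cq Cq0) => [/(_ (- x))|/(_ x)]; lra.
have le q x : C q -> inf [set q x | q in C] <= q x.
  by move=> Cq; apply: ge_inf; [case: (hi x) | exists q].
have lt x (d : R) : 0 < d -> exists2 q, C q & q x < inf [set q x | q in C] + d.
  by move=> d0; have [_ [q Cq <-] h] := inf_adherent d0 (hi x); exists q.
split=> //; split.
  move=> x y; apply/ler_addgt0Pr => d d0.
  have d2 : 0 < d / 2 by rewrite divr_gt0.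
  have [q Cq qx] := lt x _ d2; have [q' Cq' qy] := lt y _ d2.
  case: (Ctot q q' Cq Cq') => h.
    apply: le_trans (le q _ Cq) _.
    by have := (Csub _ Cq).1 x y; have := h y; lra.
  apply: le_trans (le q' _ Cq') _.
  by have := (Csub _ Cq').1 x y; have := h x; lra.
move=> t x t0; apply/ler_addgt0Pr => d d0.
have [q Cq qx] := lt x _ (divr_gt0 d0 t0).
apply: le_trans (le q _ Cq) _; apply: le_trans ((Csub _ Cq).2 t x t0) _.
by move: qx; rewrite -(ltr_pM2l t0) mulrDr [t * (d / t)]mulrC mulfVK ?lt0r_neq0 // => /ltW.
Qed.

(* A minimal sublinear functional below [p] is linear. *)
Lemma hahn_banach p : sublinear p -> exists f : V -> R,
  [/\ forall x y, f (x + y) = f x + f y,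
      forall t x, f (t%:C *: x) = t * f x & forall x, f x <= p x].
Proof.
move=> sp; pose B (q : V -> R) := sublinear q /\ forall x, q x <= p x.
pose T := {q : V -> R | B q}.
(* The order is reversed so that a maximal element for Zorn's lemma is a minimal functional. *)
pose le (q q' : T) : bool := `[< forall x, sval q' x <= sval q x >].
have [|||C Ctot|[q [sq qp]] qmin] := @Zorn T le.
- by move=> q; apply/asboolP.
- move=> q r s /asboolP h1 /asboolP h2; apply/asboolP => x.
  exact: le_trans (h2 x) (h1 x).
- move=> [q hq] [r hr] /asboolP /= h1 /asboolP /= h2; apply: eq_exist => /=.
  by apply/funext => x; apply/eqP; rewrite eq_le h1 h2.
- have [[q0 Cq0]|C0] := pselect (C !=set0); last first.
    by exists (exist B p (conj sp (fun x => lexx (p x)))) => s Cs; case: C0; exists s.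
  have [||| sI leI] := @sublinear_chain_inf p (sval @` C).
  + by exists (sval q0); exists q0.
  + by move=> _ [[q [sq qp]] _ <-].
  + move=> _ _ [q Cq <-] [r Cr <-].
    by case: (Ctot q r Cq Cr) => /asboolP h; [right | left].
  have Ip x : inf [set q x | q in sval @` C] <= p x.
    by apply: le_trans (leI (sval q0) x _) _; [exists q0 | case: (q0) => q [sq qp] /=].
  exists (exist B _ (conj sI Ip)) => q Cq; apply/asboolP => x /=.
  by apply: leI; exists q.
have qE x : shift q x = q.
  have h : sublinear (shift q x) /\ forall y, shift q x y <= p y.
    split; first exact: sublinear_shift.
    by move=> y; apply: le_trans (qp y); apply: shift_le_id.
  have hle : le (exist _ q (conj sq qp)) (exist _ (shift q x) h).
    by apply/asboolP => y; apply: shift_le_id.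
  by case: (qmin _ hle).
have qD x y : q (x + y) = q x + q y.
  apply/eqP; rewrite eq_le sq.1 /=; have := shift_le x sq y ler01.
  by rewrite qE scale1r mul1r addrC [y + x]addrC; lra.
have qN x : q (- x) = - q x.
  by have := qD x (- x); rewrite subrr (sublinear0 sq); lra.
exists q; split=> // t x; have [t0|t0|<-] := ltrgtP 0 t.
- exact: sublinearZ.
- rewrite -[t]opprK rmorphN scaleNr qN (sublinearZ _ sq) ?oppr_gt0 //; lra.
- by rewrite scale0r (sublinear0 sq) mul0r.
Qed.

End HahnBanach.

(** * States *)

Section BoundedLinear.
Context {R : realType} {V W : normedModType R[i]}.

Lemma bounded_continuous (f : V -> W) (k : R) :
  linear f -> (forall x, rnorm (f x) <= k * rnorm x) -> continuous f.
Proof.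
move=> fl fk x U /nbhs_rnorm[r r0 hU]; apply/nbhs_rnorm.
have k0 : 0 < `|k| + 1 by rewrite ltr_wpDl.
exists (r / (`|k| + 1)); first by rewrite divr_gt0.
move=> y; rewrite ltr_pdivlMr // => hy; apply: hU.
have -> : f x - f y = f (x - y).
  by have := fl (-1) y x; rewrite !scaleN1r [- y + x]addrC [- f y + f x]addrC.
apply: le_lt_trans (fk _) (le_lt_trans _ hy).
by have := ler_norm k; have := rnorm_ge0 (x - y); nra.
Qed.

Lemma continuous_bounded (f : V -> W) : linear f -> continuous f ->
  exists2 k : R, 0 <= k & forall x, rnorm (f x) <= k * rnorm x.
Proof.
move=> fl fc; have fZ c x : f (c *: x) = c *: f x.
  have f0 : f 0 = 0 by have := fl (-1) 0 0; rewrite !scaleN1r !addNr.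
  by rewrite -[c *: x]addr0 fl f0 addr0.
have f0 : f 0 = 0 by rewrite -(scale0r (0 : V)) fZ scale0r.
have : nbhs (0 : V) (f @^-1` [set y | rnorm (0 - y) < 1]).
  by apply: fc; apply/nbhs_rnorm; exists 1 => // y; rewrite f0.
move=> /nbhs_rnorm[r r0 h]; have h2 : 0 <= 2 / r by rewrite divr_ge0 // ltW.
exists (2 / r) => // x; have [->|x0] := eqVneq x 0; first by rewrite f0 !rnorm0 mulr0.
have nx : 0 < rnorm x by rewrite rnorm_gt0.
pose t := r / (2 * rnorm x); have t0 : 0 < t by rewrite divr_gt0 // mulr_gt0.
have tx : t * rnorm x = r / 2 by rewrite /t; field; rewrite lt0r_neq0.
have := h (t%:C *: x); rewrite /= !sub0r !rnormN fZ !rnormZ rnormR gtr0_norm // tx.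
have r2 : r / 2 < r by lra.
move=> /(_ r2) hf; rewrite -(ler_pM2l t0) mulrCA tx.
by apply: le_trans (ltW hf) _; rewrite (_ : 2 / r * (r / 2) = 1) //; field; rewrite lt0r_neq0.
Qed.

End BoundedLinear.

Section States.
Context {R : realType} {A : cstarType R} {e : A} (he : is_unity e).
Local Notation U := (ualg he).
Local Notation C := (R[i]^o).
Implicit Types (a b x : U) (mu : A -> C).

Section PositiveFunctional.
Variable mu : A -> C.
Hypotheses (mul : linear mu) (mup : positive mu).

Lemma functionalD a b : mu (a + b) = mu a + mu b.
Proof. by rewrite -[a]scale1r mul !scale1r. Qed.

Lemma functional0 : mu 0 = 0.
Proof. by have := mul (-1) 0 0; rewrite !scaleN1r !addNr. Qed.

Lemma functionalZ (c : R[i]) a : mu (c *: a) = c * mu a.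
Proof. by have := mul c a 0; rewrite !addr0 functional0 addr0. Qed.

Lemma functional_shift_gram (c : R[i]) a : mu (adj (a + c%:A) * (a + c%:A)) =
  mu (adj a * a) + c * mu (adj a) + Num.conj c * mu a + Num.conj c * c * mu (1 : U).
Proof.
have -> : adj (a + c%:A) * (a + c%:A) =
    adj a * a + c *: adj a + Num.conj c *: a + (Num.conj c * c)%:A.
  rewrite adjD Defs.adjZ adj_one mulrDr !mulrDl -!scalerAr -!scalerAl !mulr1 !mul1r.
  by rewrite scalerA addrACA addrA [c * _]mulrC.
by rewrite !functionalD !functionalZ.
Qed.

Lemma positive_gram_ge0 a : 0 <= (mu (adj a * a) : R[i]).
Proof. exact: mup. Qed.

Lemma positive_one_ge0 : 0 <= (mu (1 : U) : R[i]).
Proof. by have := positive_gram_ge0 1; rewrite adj_one mulr1. Qed.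

Lemma positive_adj a : mu (adj a) = Num.conj (mu a).
Proof.
have [h1 _] := nonneg_Re positive_one_ge0; have [ha _] := nonneg_Re (positive_gram_ge0 a).
have key (c : R[i]) : complex.Im (c * mu (adj a) + Num.conj c * mu a) = 0.
  have := nonneg_Re (positive_gram_ge0 (a + c%:A)); rewrite functional_shift_gram.
  rewrite ha h1; move=> [/(congr1 (@complex.Im R))] /=.
  move: (complex.Re _) (complex.Re _) => s t.
  by case: c => c1 c2; case: (mu (adj a)) => x1 x2; case: (mu a) => y1 y2 /=; lra.
have := key 1; have := key 'i; rewrite conjCi rmorph1 !mul1r.
case: (mu (adj a)) => x1 x2; case: (mu a) => y1 y2 /= k1 k2.
by apply/eqP; rewrite eq_complex /=; apply/andP; split; apply/eqP; lra.
Qed.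

Lemma positive_cauchy_schwarz a :
  rnorm (mu a) ^+ 2 <= complex.Re (mu (1 : U)) * complex.Re (mu (adj a * a)).
Proof.
have [h1 k0] := nonneg_Re positive_one_ge0; have [ha X0] := nonneg_Re (positive_gram_ge0 a).
set k := complex.Re _ in h1 k0 *; set X := complex.Re _ in ha X0 *.
set L := rnorm (mu a) ^+ 2; have L0 : 0 <= L by apply: sqr_ge0.
have key s : 0 <= X - 2 * s * L + s ^+ 2 * L * k.
  have [_] := nonneg_Re (positive_gram_ge0 (a - (s%:C * mu a)%:A)).
  rewrite -scaleNr functional_shift_gram positive_adj ha h1.
  rewrite /L rnorm_sqr -/X; case: (mu a) => x1 x2 /=; lra.
have [kp|kn] := ltP 0 k.
  have := key k^-1; have -> : X - 2 * k^-1 * L + k^-1 ^+ 2 * L * k = (k * X - L) / k.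
    by field; rewrite lt0r_neq0.
  by rewrite pmulr_lge0 ?invr_gt0 //; lra.
have k00 : k = 0 by lra.
have [Lp|] := ltP 0 L; last by rewrite k00; lra.
(* With [k = 0] the bound [key] is linear in [s], and this [s] turns it into [0 <= -1]. *)
have := key ((X + 1) / (2 * L)); rewrite k00 mulr0 addr0.
have -> : 2 * ((X + 1) / (2 * L)) * L = X + 1 by field; rewrite lt0r_neq0.
lra.
Qed.

(** By Cauchy-Schwarz it is enough that [mu (a^* a) <= |a|^2]. For [d > 0] the element
    [|a|^2 + d - a^* a] is the square of a self-adjoint element, on which [mu] is nonnegative; the
    slack [d] meets the strict hypothesis of [sqrt_above]. *)
Lemma positive_unital_norm a : mu (1 : U) = 1 -> rnorm (mu a) <= rnorm a.
Proof.
move=> m1; have := positive_cauchy_schwarz a; rewrite m1 /= mul1r => h.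
rewrite -(@ler_sqr _ (rnorm (mu a))) ?nnegrE ?rnorm_ge0 //.
apply: le_trans h _; apply/ler_addgt0Pr => d d0.
have aa : adj (adj a * a) = adj a * a by rewrite adj_mul adjK.
have [|x [xa xx _]] := @sqrt_above _ _ _ he _ (rnorm a ^+ 2 + d) aa.
  have := @umax_le _ _ _ he 0 (adj a * a).
  by rewrite /rscal scale0r add0r subr0 rnorm_cstar; lra.
have [_] := nonneg_Re (positive_gram_ge0 x); rewrite xa -xx.
rewrite functionalD functionalZ m1 mulr1 -scaleN1r functionalZ mulN1r raddfB /=; lra.
Qed.

Lemma positive_unital_state : mu (1 : U) = 1 -> state mu.
Proof.
move=> m1; split => //.
- split => //; apply: (@bounded_continuous _ _ C mu 1) => // x.
  by rewrite mul1r; apply: positive_unital_norm.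
- by move=> a; rewrite !rnormE lecR; apply: positive_unital_norm.
- by move=> c /(_ (1 : U)); rewrite m1 normr1 rnormE rnorm_one mulr1.
Qed.

End PositiveFunctional.

Lemma state_linear mu : state mu -> linear mu.
Proof. by case=> -[]. Qed.

Lemma stateB mu (a b : A) : state mu -> mu (a - b) = mu a - mu b.
Proof.
move=> sm; have := state_linear sm (-1) b a.
by rewrite !scaleN1r [- b + a]addrC [- _ + mu a]addrC.
Qed.

(** Cauchy-Schwarz gives [|mu a| <= sqrt (mu 1) |a|], so norm one forces [sqrt (mu 1) >= 1]. *)
Lemma state_unital mu : state mu -> mu e = 1.
Proof.
move=> [[ml mc] mp mn mc1].
have [h1 k0] := nonneg_Re (positive_one_ge0 mp).
set k := complex.Re _ in h1 k0; rewrite -[e]/(1 : U) h1.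
have k1 : k <= 1.
  apply: le_trans (ler_Re _) _; have := mn (1 : U).
  by rewrite !rnormE lecR rnorm_one.
suff : 1 <= Num.sqrt k.
  move=> hk; have : k = 1; last by move=> ->.
  apply/eqP; rewrite eq_le k1 -(sqr_sqrtr k0).
  by rewrite exprn_ege1.
have := mc1 (Num.sqrt k)%:C; rewrite -[1]/(1%:C) lecR; apply => a.
rewrite !rnormE -rmorphM lecR -(@ler_sqr _ (rnorm (mu a))) ?nnegrE ?rnorm_ge0 //;
  last by rewrite mulr_ge0 ?sqrtr_ge0 ?rnorm_ge0.
rewrite exprMn sqr_sqrtr //; apply: le_trans (positive_cauchy_schwarz ml mp a) _.
rewrite -/k ler_wpM2l //; apply: le_trans (ler_Re _) _.
by have := mn (cmul (adj a) a); rewrite !rnormE lecR rnorm_cstar.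
Qed.

Lemma exists_state : exists mu : A -> C, state mu.
Proof.
have [|f [fD fZ fM]] := @hahn_banach R U (@umax R A e he).
  by split; [exact: umaxD | exact: umaxZ_le].
have f0 : f 0 = 0 by have := fD 0 0; rewrite addr0; lra.
have fN a : f (- a) = - f a by have := fD a (- a); rewrite subrr f0; lra.
(* The Hahn-Banach functional [f] is only real-linear. Its values on self-adjoint elements are kept
   and extended complex-linearly. *)
pose re a : U := (2^-1)%:C *: (a + adj a).
pose im a : U := (2^-1)%:C *: (- 'i *: (a - adj a)).
have reD a b : re (a + b) = re a + re b by rewrite /re adjD addrACA scalerDr.
have imD a b : im (a + b) = im a + im b.
  by rewrite /im adjD opprD addrACA !scalerDr.
have reR (t : R) a : re (t%:C *: a) = t%:C *: re a.
  by rewrite /re adj_scale -scalerDr !scalerA mulrC.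
have imR (t : R) a : im (t%:C *: a) = t%:C *: im a.
  by rewrite /im adj_scale -scalerBr !scalerA mulrC mulrA [t%:C * _]mulrC.
have ii : ('i : R[i]) * 'i = - 1 by rewrite -expr2 sqrCi.
have rei a : re ('i *: a) = - im a.
  by rewrite /re /im Defs.adjZ conjCi !scaleNr -scalerBr scalerN opprK.
have imi a : im ('i *: a) = re a.
  by rewrite /re /im Defs.adjZ conjCi !scaleNr opprK -scalerDr scalerA ii scaleN1r opprK.
pose F : A -> C := fun a => f (re a) +i* f (im a).
have FD a b : F (a + b) = F a + F b by rewrite /F reD imD !fD.
have FR (t : R) a : F (t%:C *: a) = t%:C * F a.
  rewrite /F reR imR !fZ; apply/eqP; rewrite eq_complex /=.
  by apply/andP; split; apply/eqP; lra.
have Fi a : F ('i *: a) = 'i * F a.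
  rewrite /F rei imi fN; apply/eqP; rewrite eq_complex /=.
  by apply/andP; split; apply/eqP; lra.
have Fl : linear F.
  move=> c a b; rewrite FD; congr (_ + _).
  have -> : c *: a = (complex.Re c)%:C *: a + (complex.Im c)%:C *: ('i *: a).
    rewrite scalerA -scalerDl; congr (_ *: _); apply/eqP; rewrite eq_complex /=.
    by apply/andP; split; apply/eqP; lra.
  rewrite FD !FR Fi; apply/eqP; rewrite eq_complex; case: c => c1 c2 /=.
  by case: (F a) => x1 x2 /=; apply/andP; split; apply/eqP; lra.
have Fsa a : adj a = a -> F a = (f a)%:C.
  move=> aa; rewrite /F /re /im aa subrr !scaler0 f0 fZ fD; congr (_ +i* _); lra.
exists F; apply: positive_unital_state => //.
  move=> a; rewrite Fsa ?adjM ?adjK // lecR.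
  have := le_trans (fM _) (@umax_opp_gram _ _ _ he a).
  by rewrite fN -[cmul _ _]/(_ * _ : U); lra.
rewrite Fsa ?adj_one // -[RHS]/(1%:C); congr (_ %:C).
have r1 (t : R) : (t%:C *: 1 : U) = rscal he t by [].
have := fM 1; have := fM (- 1); have := @umax_rscal _ _ _ he 1.
have := @umax_rscal _ _ _ he (- 1); rewrite rscalN -r1 scale1r fN; lra.
Qed.

End States.

(** * Compactness of the state space *)

Section UltrafilterLimits.
Context {R : realType} {T : Type} (F : set_system T) {FU : UltraFilter F}.

Lemma ultrafilter_real_limit (g : T -> R) (k : R) : F [set t | `|g t| <= k] ->
  exists l, forall d : R, 0 < d -> F [set t | `|l - g t| < d].
Proof.
move=> gk; pose S := [set x | F [set t | x <= g t]].
have hs : has_sup S.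
  split.
    exists (- k); apply: filterS gk => t /=; rewrite ler_norml; by case/andP.
  exists k => x Sx; have [t /= [h1 h2]] := filter_ex (filterI Sx gk).
  by have := ler_norm (g t); lra.
exists (sup S) => d d0.
have [x Sx hx] := sup_adherent d0 hs.
have hd : F [set t | g t < sup S + d].
  have [h|] := in_ultra_setVsetC [set t | sup S + d <= g t] FU; last first.
    by apply: filterS => t /= /negP; rewrite -ltNge.
  by have := ub_le_sup hs.2 h; lra.
apply: filterS (filterI Sx hd) => t /= [h1 h2].
by rewrite ltr_norml; lra.
Qed.

Lemma ultrafilter_complex_limit (g : T -> R[i]) (k : R) : F [set t | rnorm (g t) <= k] ->
  exists l, forall d : R, 0 < d -> F [set t | rnorm (l - g t) < d].
Proof.
move=> gk.
have [|x hx] := @ultrafilter_real_limit (fun t => complex.Re (g t)) k.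
  by apply: filterS gk => t /=; apply: le_trans (ler_absRe _).
have [|y hy] := @ultrafilter_real_limit (fun t => complex.Im (g t)) k.
  by apply: filterS gk => t /=; apply: le_trans (ler_absIm _).
exists (x +i* y) => d d0; have d2 : 0 < d / 2 by rewrite divr_gt0.
apply: filterS (filterI (hx _ d2) (hy _ d2)) => t /= [h1 h2].
apply: le_lt_trans (rnorm_le_ReIm _) _.
by case: (g t) h1 h2 => a b /=; lra.
Qed.

End UltrafilterLimits.

Section StateCompactness.
Context {R : realType} {A : cstarType R} {e : A} (he : is_unity e).
Local Notation C := (R[i]^o).

Lemma state_rnorm (mu : A -> C) a : state mu -> rnorm (mu a) <= rnorm a.
Proof. by case=> _ _ /(_ a); rewrite !rnormE lecR. Qed.

(* The state space of a unital C*-algebra is weak-* compact. *)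
Lemma state_compact (F : set_system (A -> C)) : ProperFilter F -> F (@state R A) ->
  exists M : A -> C, state M /\
    forall a (r : R), F [set mu | rnorm (mu a) <= r] -> rnorm (M a) <= r.
Proof.
move=> FP Fs; have [G [GU FG]] := ultraFilterLemma FP.
have Gs := FG _ Fs.
have lim a : exists l : C, forall d : R, 0 < d -> G [set mu | rnorm (l - mu a) < d].
  apply: (@ultrafilter_complex_limit _ _ G GU (fun mu => mu a) (rnorm a)).
  by apply: filterS Gs => mu; apply: state_rnorm.
have [M HM] := choice lim.
have approx a b c (d : R) : 0 < d -> exists2 mu, state mu &
    [/\ rnorm (M a - mu a) < d, rnorm (M b - mu b) < d & rnorm (M c - mu c) < d].
  move=> d0; have [mu [[h1 h2] [h3 h4]]] := filter_ex
    (filterI (filterI (HM a d d0) (HM b d d0)) (filterI (HM c d d0) Gs)).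
  by exists mu.
have Ml : linear M.
  move=> k a b; apply: rnorm_eq_eps => d d0; pose q := rnorm k + 2.
  have q0 : 0 < q by have := rnorm_ge0 k; rewrite /q; lra.
  have [mu sm [h1 h2 h3]] := approx a b (k *: a + b) (d / q) (divr_gt0 d0 q0).
  have -> : M (k *: a + b) - (k *: M a + M b) =
      (M (k *: a + b) - mu (k *: a + b)) - (k *: (M a - mu a) + (M b - mu b)).
    rewrite (state_linear sm) scalerBr [k *: M a - _ + _]addrACA -opprD.
    by rewrite opprB addrA subrK.
  apply: le_trans (rnormB _ _) _; apply: le_trans (lerD (lexx _) (rnormD _ _)) _.
  rewrite rnormZ; have h4 := ler_wpM2l (rnorm_ge0 k) (ltW h1).
  have : q * (d / q) = d by rewrite mulrC mulfVK // lt0r_neq0.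
  by rewrite {1}/q; lra.
have Mp : positive M.
  move=> a; pose z : A := cmul (adj a) a.
  have hz (d : R) : 0 < d -> `|complex.Im (M z)| <= d /\ - d <= complex.Re (M z).
    move=> d0; have [mu [_ /(_ a) mp _ _] [h1 _ _]] := approx z z z d d0.
    have := nonneg_Re mp; have := ler_absRe (M z - mu z).
    have := ler_absIm (M z - mu z); rewrite -/z.
    move: h1; set n := rnorm _; case: (M z) => x y; case: (mu z) => x' y' /=.
    move=> h1 h2 h3 [/(congr1 (@complex.Im R)) /= h4 h5].
    by move: h2 h3; rewrite h4 subr0 ![`|x - x'| <= _]ler_norml; lra.
  rewrite -/z lecE /=; apply/andP; split.
    rewrite -normr_le0; apply/ler_addgt0Pr => d /hz[h _]; lra.
  by apply/ler_addgt0Pr => d /hz[_ h]; lra.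
(* With a unit, norm one for a positive functional is a condition at the single point [e], and so it
   passes to the limit. *)
have M1 : M e = 1.
  apply: rnorm_eq_eps => d d0; have [mu sm [h1 _ _]] := approx e e e d d0.
  by rewrite -(state_unital he sm); apply: ltW.
exists M; split; first exact: (@positive_unital_state _ _ _ he).
move=> a r /FG Gr; apply/ler_addgt0Pr => d d0.
have [mu /= [h1 h2]] := filter_ex (filterI Gr (HM a d d0)).
by have := rnormD (M a - mu a) (mu a); rewrite subrK; lra.
Qed.

End StateCompactness.

(** * Normal functionals *)

Section ComplexSeries.
Context {R : realType}.
Local Notation C := (R[i]^o).
Implicit Types u v : nat -> C.

Lemma csumE u (l : C) : series u @ \oo --> l -> csum u = l.
Proof. exact: (@cvg_lim _ (@norm_hausdorff _ C)). Qed.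

Lemma series_lin u v (c l m : C) : series u @ \oo --> l -> series v @ \oo --> m ->
  series (fun n => c * u n + v n) @ \oo --> (c * l + m : C).
Proof.
move=> /cvg_rnorm ul /cvg_rnorm vm; apply/cvg_rnorm => d d0; pose q := rnorm c + 1.
have q0 : 0 < q by have := rnorm_ge0 c; rewrite /q; lra.
have dq := divr_gt0 d0 q0.
apply: filterS (filterI (ul _ dq) (vm _ dq)) => n /= [h1 h2].
have -> : series (fun n => c * u n + v n) n = c * series u n + series v n.
  by rewrite !seriesEord /= mulr_sumr -big_split.
have -> : c * l + m - (c * series u n + series v n) =
    c * (l - series u n) + (m - series v n) by ring.
apply: le_lt_trans (rnormD _ _) _; rewrite rnormM.
have h3 := ler_wpM2l (rnorm_ge0 c) (ltW h1).
have : q * (d / q) = d by rewrite mulrC mulfVK // lt0r_neq0.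
by move: h2 h3; set x := d / q; rewrite /q; lra.
Qed.

Lemma series_head u : (forall n, u n.+1 = 0) -> series u @ \oo --> u 0%N.
Proof.
move=> h; rewrite -cvg_shiftS.
have -> : [sequence series u n.+1]_n = cst (u 0%N); last exact: cvg_cst.
apply/funext => n; rewrite /= seriesEord /= big_ord_recl big1 ?addr0 // => i _.
exact: h.
Qed.

Lemma real_series_cvg (g : R ^nat) (B : R) :
  (forall n, \sum_(i < n) `|g i| <= B) -> cvgn (series g).
Proof.
move=> gB; apply: normed_cvg.
have -> : [normed series g] = (fun n => \sum_(i < n) `|g i|).
  by apply/funext => n; rewrite /normed_series_of seriesEord.
apply: nondecreasing_is_cvgn; last by exists B => _ [n _ <-].
by apply/nondecreasing_seqP => n; rewrite big_ord_recr lerDl normr_ge0.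
Qed.

Lemma series_abs_cvg u (B : R) :
  (forall n, \sum_(i < n) rnorm (u i : C) <= B) -> series u @ \oo --> csum u.
Proof.
move=> uB; have hre : cvgn (series (fun n => complex.Re (u n))).
  apply: (@real_series_cvg _ B) => n; apply: le_trans (uB n).
  by apply: ler_sum => i _; apply: ler_absRe.
have him : cvgn (series (fun n => complex.Im (u n))).
  apply: (@real_series_cvg _ B) => n; apply: le_trans (uB n).
  by apply: ler_sum => i _; apply: ler_absIm.
suff h : series u @ \oo --> (lim (series (fun n => complex.Re (u n)) @ \oo) +i*
    lim (series (fun n => complex.Im (u n)) @ \oo) : C) by rewrite (csumE h).
apply/cvg_rnorm => r r0; have r2 : 0 < r / 2 by rewrite divr_gt0.
have /cvgrPdist_lt/(_ _ r2) h1 := hre.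
have /cvgrPdist_lt/(_ _ r2) h2 := him.
have E n : series u n = series (fun n => complex.Re (u n)) n +i*
    series (fun n => complex.Im (u n)) n :> C.
  rewrite !seriesEord /=; elim: n => [|n IH]; first by rewrite !big_ord0.
  by rewrite !big_ord_recr /= IH; case: (u n).
near=> n; apply: le_lt_trans (rnorm_le_ReIm _) _.
rewrite E /=.
have a1 : `|lim (series (fun n => complex.Re (u n)) @ \oo) -
  series (fun n => complex.Re (u n)) n| < r / 2 by near: n.
have a2 : `|lim (series (fun n => complex.Im (u n)) @ \oo) -
  series (fun n => complex.Im (u n)) n| < r / 2 by near: n.
by lra.
Unshelve. all: by end_near.
Qed.

Lemma rnorm_limit_le u (l : C) (B : R) : u @ \oo --> l -> (forall n, rnorm (u n : C) <= B) ->
  rnorm l <= B.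
Proof.
move=> /cvg_rnorm ul uB; apply/ler_addgt0Pr => d d0.
have [n /= hn] := filter_ex (ul d d0).
by have := rnormD (l - u n) (u n : C); rewrite subrK; have := uB n; lra.
Qed.

End ComplexSeries.

Section NormalForms.
Context {R : realType} {G : hilbertType R}.
Local Notation C := (R[i]^o).
Implicit Types (w : nform G) (x y z : G).

Lemma sqsummableP (x : nat -> G) : sqsummable x <->
  exists B : R, forall n, \sum_(i < n) rnorm (x i) ^+ 2 <= B.
Proof.
have E n : series (fun n => `|x n| ^+ 2 : C) n = (\sum_(i < n) rnorm (x i) ^+ 2)%:C.
  rewrite seriesEord /= rmorph_sum; apply: eq_bigr => i _.
  by rewrite rnormE rmorphXn.
split=> [/cvg_ex[l hl]|[B hB]].
  have [m _ hm] : \forall n \near \oo, rnorm (l - series (fun n => `|x n| ^+ 2 : C) n) < 1.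
    by move/cvg_rnorm : hl; apply.
  exists (rnorm l + 1) => n.
  have hmn := hm (maxn m n) (leq_maxl _ _).
  have : \sum_(i < n) rnorm (x i) ^+ 2 <= \sum_(i < maxn m n) rnorm (x i) ^+ 2.
    rewrite (big_ord_widen (maxn m n) (fun i => rnorm (x i) ^+ 2) (leq_maxr m n)).
    rewrite big_mkcond /=; apply: ler_sum => i _.
    by case: ifP => // _; apply: sqr_ge0.
  move: hmn; rewrite /= E; set s := \sum_(i < maxn _ _) _ => hmn.
  have := rnormD (s%:C - l) l; rewrite subrK rnormR rnormBC.
  by have := ler_norm s; lra.
apply/cvg_ex; exists (csum (fun n => `|x n| ^+ 2 : C)).
apply: (@series_abs_cvg _ _ B) => n; apply: le_trans (hB n).
by apply: ler_sum => i _; rewrite rnormE -rmorphXn rnormR ger0_norm // sqr_ge0.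
Qed.

Lemma bops_bound (T : G -> G) : bops T ->
  exists2 k : R, 0 <= k & forall x, rnorm (T x) <= k * rnorm x.
Proof. by case; apply: continuous_bounded. Qed.

Lemma normal_abs_bound w : normal w ->
  exists B : R, forall n, \sum_(i < n) rnorm (w.1 i) * rnorm (w.2 i) <= B.
Proof.
move=> [/sqsummableP[B1 h1] /sqsummableP[B2 h2]]; exists (B1 + B2) => n.
apply: le_trans (lerD (h1 n) (h2 n)); rewrite -big_split /=.
apply: ler_sum => i _; have := sqr_ge0 (rnorm (w.1 i) - rnorm (w.2 i)).
by have := sqr_ge0 (rnorm (w.1 i)); have := sqr_ge0 (rnorm (w.2 i)); lra.
Qed.

Lemma nval_cvg w (T : G -> G) : normal w -> bops T ->
  series (fun n => '<T (w.1 n), w.2 n> : C) @ \oo --> nval w T.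
Proof.
move=> /normal_abs_bound[B hB] /bops_bound[k k0 hk].
apply: (@series_abs_cvg _ _ (k * B)) => n; apply: le_trans (ler_wpM2l k0 (hB n)).
rewrite mulr_sumr; apply: ler_sum => i _; apply: le_trans (cauchy_schwarz _ _) _.
by rewrite mulrA ler_wpM2r ?rnorm_ge0.
Qed.

Lemma nval_sum w n (s : 'I_n -> G -> G) : normal w -> (forall i, bops (s i)) ->
  nval w (fun z => \sum_(i < n) s i z) = \sum_(i < n) nval w (s i).
Proof.
move=> nw sb; apply: csumE; elim: n s sb => [|n IH] s sb.
  have -> : (fun m => '<\sum_(i < 0) s i (w.1 m), w.2 m> : C) = fun=> 0.
    by apply/funext => m; rewrite big_ord0 inner0l.
  by rewrite big_ord0; apply: (@series_head _ (fun=> 0)).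
have := series_lin (c := 1) (nval_cvg nw (sb ord0)) (IH (fun i => s (lift ord0 i)) (fun i => sb _)).
rewrite big_ord_recl mul1r.
have -> // : (fun m => 1 * '<s ord0 (w.1 m), w.2 m> +
    '<\sum_(i < n) s (lift ord0 i) (w.1 m), w.2 m> : C) =
  (fun m => '<\sum_(i < n.+1) s i (w.1 m), w.2 m> : C).
by apply/funext => m; rewrite big_ord_recl innerDl mul1r.
Qed.

Definition vform x y : nform G :=
  (fun n => if n is 0%N then x else 0, fun n => if n is 0%N then y else 0).

Lemma normal_vform x y : normal (vform x y).
Proof.
have h z : sqsummable (fun n => if n is 0%N then z else 0 : G).
  apply/sqsummableP; exists (rnorm z ^+ 2) => -[|n].
    by rewrite big_ord0 sqr_ge0.
  by rewrite big_ord_recl big1 ?addr0 // => i _; rewrite /= rnorm0 expr0n.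
by split; apply: h.
Qed.

Lemma nval_vform x y (T : G -> G) : nval (vform x y) T = '<T x, y>.
Proof. by apply: csumE; apply: series_head => n; rewrite inner0r. Qed.

(** This lets sequences picked by [xget] be traded for convenient vectors. A neighbourhood for both
    functionals at once gives one [s] in [S] close to [T] for each. *)
Lemma uw_closure_eq (S : set (G -> G)) (w w' : nform G) : normal w -> normal w' ->
  (forall s, S s -> nval w s = nval w' s) ->
  forall T, uw_closure S T -> nval w T = nval w' T.
Proof.
move=> nw nw' h T [_ hT]; apply: rnorm_eq_eps => d d0.
have d2 : 0 < d / 2 by rewrite divr_gt0.
have [|s Ss hs] := hT 2%N (fun i => if i == ord0 then w else w') _ _ d2.
  by move=> i; case: ifP.
have := hs ord0; have := hs (lift ord0 ord0); rewrite /= !rnormE !ltcR (h s Ss) => h1 h2.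
have := rnorm_dist (nval w' s) (nval w T) (nval w' T).
by rewrite (rnormBC (nval w' s)); lra.
Qed.

End NormalForms.

(** * Tensor products and the universal representation *)

Section Tensors.
Context {R : realType} {K H L : hilbertType R} {t : K -> H -> L}.
Local Notation C := (R[i]^o).
Hypothesis ht : hilbert_tensor t.

Lemma tensorDZr k (c : R[i]) h h' : t k (c *: h + h') = c *: t k h + t k h'.
Proof. by case: ht => tl _ _ _; rewrite tl. Qed.

Lemma tensorDZl h (c : R[i]) k k' : t (c *: k + k') h = c *: t k h + t k' h.
Proof. by case: ht => _ tl _ _; rewrite (tl h). Qed.

Lemma tensor0r k : t k 0 = 0.
Proof. by have := tensorDZr k (-1) 0 0; rewrite !scaleN1r !addNr. Qed.

Lemma tensor0l h : t 0 h = 0.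
Proof. by have := tensorDZl h (-1) 0 0; rewrite !scaleN1r !addNr. Qed.

Lemma inner_tensor k h k' h' : '<t k h, t k' h'> = '<k, k'> * '<h, h'>.
Proof. by case: ht. Qed.

Lemma rnorm_tensor k h : rnorm (t k h) = rnorm k * rnorm h.
Proof.
apply/eqP; rewrite -(@eqrXn2 _ 2) ?rnorm_ge0 ?mulr_ge0 ?rnorm_ge0 // exprMn.
have := inner_tensor k h k h; rewrite !inner_self -rmorphM => -[] /=.
by move=> ->.
Qed.

(** The functional on B(L) whose value at [X] is the matrix coefficient at [k1], [k2] of the slice
    of [X] by [v]; [lform] is its mirror image. *)
Definition rform (k1 k2 : K) (v : nform H) : nform L :=
  (fun m => t k1 (v.1 m), fun m => t k2 (v.2 m)).

Definition lform (h1 h2 : H) (u : nform K) : nform L :=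
  (fun n => t (u.1 n) h1, fun n => t (u.2 n) h2).

Lemma normal_rform k1 k2 v : normal v -> normal (rform k1 k2 v).
Proof.
move=> [/sqsummableP[B1 h1] /sqsummableP[B2 h2]]; split; apply/sqsummableP.
  exists (rnorm k1 ^+ 2 * B1) => n; apply: le_trans (ler_wpM2l (sqr_ge0 _) (h1 n)).
  by rewrite mulr_sumr; apply: ler_sum => i _; rewrite rnorm_tensor exprMn.
exists (rnorm k2 ^+ 2 * B2) => n; apply: le_trans (ler_wpM2l (sqr_ge0 _) (h2 n)).
by rewrite mulr_sumr; apply: ler_sum => i _; rewrite rnorm_tensor exprMn.
Qed.

Lemma normal_lform h1 h2 u : normal u -> normal (lform h1 h2 u).
Proof.
move=> [/sqsummableP[B1 b1] /sqsummableP[B2 b2]]; split; apply/sqsummableP.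
  exists (rnorm h1 ^+ 2 * B1) => n; apply: le_trans (ler_wpM2l (sqr_ge0 _) (b1 n)).
  by rewrite mulr_sumr; apply: ler_sum => i _; rewrite rnorm_tensor exprMn mulrC.
exists (rnorm h2 ^+ 2 * B2) => n; apply: le_trans (ler_wpM2l (sqr_ge0 _) (b2 n)).
by rewrite mulr_sumr; apply: ler_sum => i _; rewrite rnorm_tensor exprMn mulrC.
Qed.

Lemma rform_vform k1 k2 h1 h2 : rform k1 k2 (vform h1 h2) = vform (t k1 h1) (t k2 h2).
Proof. by congr (_, _); apply/funext => -[|m] //=; rewrite tensor0r. Qed.

Lemma lform_vform h1 h2 k1 k2 : lform h1 h2 (vform k1 k2) = vform (t k1 h1) (t k2 h2).
Proof. by congr (_, _); apply/funext => -[|m] //=; rewrite tensor0l. Qed.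

Lemma nval_rform_op_tensor k1 k2 v x y (T : L -> L) : normal v -> bops y ->
  op_tensor t x y T -> nval (rform k1 k2 v) T = '<x k1, k2> * nval v y.
Proof.
move=> nv yb [_ hT]; apply: csumE.
have := series_lin (c := '<x k1, k2>) (nval_cvg nv yb) (@series_head _ (fun=> 0) (fun=> erefl)).
rewrite addr0; have -> // : (fun n => '<x k1, k2> * '<y (v.1 n), v.2 n> + 0 : C) =
  (fun n => '<T ((rform k1 k2 v).1 n), (rform k1 k2 v).2 n>).
by apply/funext => n; rewrite addr0 /= hT inner_tensor.
Qed.

Lemma nval_lform_op_tensor h1 h2 u x y (T : L -> L) : normal u -> bops x ->
  op_tensor t x y T -> nval (lform h1 h2 u) T = nval u x * '<y h1, h2>.
Proof.
move=> nu xb [_ hT]; apply: csumE; rewrite mulrC.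
have := series_lin (c := '<y h1, h2>) (nval_cvg nu xb) (@series_head _ (fun=> 0) (fun=> erefl)).
rewrite addr0; have -> // : (fun n => '<y h1, h2> * '<x (u.1 n), u.2 n> + 0 : C) =
  (fun n => '<T ((lform h1 h2 u).1 n), (lform h1 h2 u).2 n>).
by apply/funext => n; rewrite addr0 /= hT inner_tensor mulrC.
Qed.

Lemma vn_tensor_eq (M : set (K -> K)) (N : set (H -> H)) (w w' : nform L) :
  normal w -> normal w' ->
  (forall x y T, M x -> N y -> op_tensor t x y T -> nval w T = nval w' T) ->
  forall X, vn_tensor t M N X -> nval w X = nval w' X.
Proof.
move=> nw nw' h; apply: uw_closure_eq => // T [n [s [hs hT]]].
have -> : T = (fun z => \sum_(i < n) s i z) by apply/funext.
have sb i : bops (s i) by have [x [y [_ _ []]]] := hs i.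
rewrite !nval_sum //; apply: eq_bigr => i _.
by have [x [y [Mx Ny xy]]] := hs i; apply: h xy.
Qed.

Lemma vn_tensor_rform (M : set (K -> K)) (N : set (H -> H)) v v' :
  N `<=` @bops R H -> normal v -> normal v' ->
  (forall y, N y -> nval v y = nval v' y) ->
  forall X, vn_tensor t M N X -> forall k1 k2,
  nval (rform k1 k2 v) X = nval (rform k1 k2 v') X.
Proof.
move=> Nb nv nv' h X HX k1 k2; apply: vn_tensor_eq HX; try exact: normal_rform.
by move=> x y T Mx Ny xy; rewrite !(nval_rform_op_tensor _ _ _ _ xy) ?h //; apply: Nb.
Qed.

Lemma vn_tensor_lform (M : set (K -> K)) (N : set (H -> H)) u u' :
  M `<=` @bops R K -> normal u -> normal u' ->
  (forall x, M x -> nval u x = nval u' x) ->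
  forall X, vn_tensor t M N X -> forall h1 h2,
  nval (lform h1 h2 u) X = nval (lform h1 h2 u') X.
Proof.
move=> Mb nu nu' h X HX h1 h2; apply: vn_tensor_eq HX; try exact: normal_lform.
by move=> x y T Mx Ny xy; rewrite !(nval_lform_op_tensor _ _ _ _ xy) ?h //; apply: Mb.
Qed.

(** [tensor_val] is an iterated series, so the functionals are replaced one at a time: each inner
    series is a value of an [rform], and once [v] has become a vector functional the outer series is
    a value of an [lform]. *)
Lemma tensor_val_vector (M : set (K -> K)) (N : set (H -> H)) u v k1 k2 h1 h2 :
  M `<=` @bops R K -> N `<=` @bops R H -> normal u -> normal v ->
  (forall x, M x -> nval u x = '<x k1, k2>) ->
  (forall y, N y -> nval v y = '<y h1, h2>) ->
  forall X, vn_tensor t M N X ->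
  tensor_val t X u v = '<X (t k1 h1), t k2 h2>.
Proof.
move=> Mb Nb nu nv hu hv X HX.
have E n : csum (fun m => '<X (t (u.1 n) (v.1 m)), t (u.2 n) (v.2 m)>) =
    '<X (t (u.1 n) h1), t (u.2 n) h2>.
  rewrite -[LHS]/(nval (rform (u.1 n) (u.2 n) v) X).
  rewrite (vn_tensor_rform Nb nv (normal_vform h1 h2) _ HX).
    by rewrite rform_vform nval_vform.
  by move=> y Ny; rewrite nval_vform hv.
rewrite /tensor_val (_ : (fun n => _) = (fun n => '<X (t (u.1 n) h1), t (u.2 n) h2>)); last first.
  by apply/funext.
rewrite -[LHS]/(nval (lform h1 h2 u) X).
rewrite (vn_tensor_lform Mb nu (normal_vform k1 k2) _ HX).
  by rewrite lform_vform nval_vform.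
by move=> x Mx; rewrite nval_vform hu.
Qed.

End Tensors.
Arguments rform {R K H L} t k1 k2 v.

Section UniversalRepresentation.
Context {R : realType} {A : cstarType R} {e : A} (he : is_unity e).
Context {K : hilbertType R} {rho : A -> K -> K} (xi : (A -> R[i]^o) -> K).
Local Notation C := (R[i]^o).
Hypothesis pi_rep : star_rep rho.
Hypothesis xi_val : forall mu a, state mu -> '<rho a (xi mu), xi mu> = mu a.
Hypothesis xi_dense : dense [set z | exists n (a : 'I_n -> A) (mu : 'I_n -> A -> C),
  (forall i, state (mu i)) /\ z = \sum_(i < n) rho (a i) (xi (mu i))].

Lemma bidual_bops : bidual rho `<=` @bops R K.
Proof. by move=> T []. Qed.

Lemma normal_extP mu : state mu ->
  normal (normal_ext rho mu) /\ forall a, nval (normal_ext rho mu) (rho a) = mu a.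
Proof.
move=> sm; apply: (@xgetPex _ (fun=> 0, fun=> 0)
  [set w | normal w /\ forall a, nval w (rho a) = mu a]).
exists (vform (xi mu) (xi mu)); split; first exact: normal_vform.
by move=> a; rewrite nval_vform xi_val.
Qed.

Lemma normal_ext_bidual mu : state mu -> forall T, bidual rho T ->
  nval (normal_ext rho mu) T = '<T (xi mu), xi mu>.
Proof.
move=> sm T HT; rewrite -nval_vform; have [n1 h1] := normal_extP sm.
apply: (@uw_closure_eq _ _ (range rho) _ _ n1 (normal_vform _ _) _ T HT).
by move=> _ [a _ <-]; rewrite h1 nval_vform xi_val.
Qed.

(** A [star_rep] may be degenerate; here [rho e] fixes the vectors [rho a (xi mu)], whose span is
    dense, and is bounded. *)
Lemma universal_rep_one : rho e = id.
Proof.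
have [pb _ pm _] := pi_rep; have [_ el er] := he.
have [k k0 hk] := bops_bound (pb e).
apply/funext => z; apply: rnorm_eq_eps => d d0.
have k10 : 0 < k + 1 by lra.
have dk := divr_gt0 d0 k10.
have ballz : ball z (d / (k + 1))%:C !=set0.
  by exists z; apply: ballxx; rewrite ltcR.
have [y [hy [n [a [mu [sm yE]]]]]] := xi_dense ballz (ball_open _ _).
have pie_lin : linear (rho e) by case: (pb e).
have pie_y : rho e y = y.
  rewrite yE {hy yE sm}; elim: n a mu => [|n IH] a mu.
    by rewrite !big_ord0; have := pie_lin (-1) 0 0; rewrite !scaleN1r !addNr.
  have := pie_lin 1 (rho (a ord0) (xi (mu ord0)))
    (\sum_(i < n) rho (a (lift ord0 i)) (xi (mu (lift ord0 i)))).
  by rewrite !scale1r big_ord_recl => ->; rewrite IH -pm el.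
move: hy; rewrite ball_rnorm /= ltr_pdivlMr // => hy.
have -> : rho e z - z = rho e (z - y) - (z - y).
  have -> : rho e (z - y) = rho e z - y.
    by have := pie_lin (-1) y z; rewrite !scaleN1r pie_y addrC [- y + _]addrC.
  by rewrite opprB addrA subrK.
apply: le_trans (rnormB _ _) _; have := hk (z - y); lra.
Qed.

Lemma rnorm_state_vector mu : state mu -> rnorm (xi mu) = 1.
Proof.
move=> sm; apply/eqP; rewrite -(@eqrXn2 _ 2) ?rnorm_ge0 // expr1n.
have := xi_val e sm; rewrite universal_rep_one (state_unital he sm) inner_self.
by rewrite -[1]/(1%:C) => -[] ->.
Qed.

End UniversalRepresentation.

(** * Invariant states *)

Section Eberlein.
Context {R : realType} {A : cstarType R} {e : A} (he : is_unity e).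
Context {K H KK KH : hilbertType R}.
Context {rho : A -> K -> K} {tK : K -> K -> KK} {tH : K -> H -> KH}.
Context {Phi : A -> KK -> KK} {V : KH -> KH} (xi : (A -> R[i]^o) -> K).
Local Notation C := (R[i]^o).
Hypothesis eb : cstar_eberlein rho tK tH Phi V.
Hypothesis xi_val : forall mu a, state mu -> '<rho a (xi mu), xi mu> = mu a.
Hypothesis xi_dense : dense [set z | exists n (a : 'I_n -> A) (mu : 'I_n -> A -> C),
  (forall i, state (mu i)) /\ z = \sum_(i < n) rho (a i) (xi (mu i))].
Implicit Types (mu nu M : A -> C) (h : H) (k : K).

Local Notation conv := (Defs.conv rho tK Phi).
Local Notation tHP := (eb_tensorKH eb).

Lemma eb_rho_rep : star_rep rho.
Proof. by case: (eb_universal eb). Qed.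

Lemma conv_vector mu nu a : state mu -> state nu ->
  conv mu nu a = '<Phi a (tK (xi mu) (xi nu)), tK (xi mu) (xi nu)>.
Proof.
move=> sm sn; have [n1 _] := normal_extP xi_val sm.
have [n2 _] := normal_extP xi_val sn.
apply: (tensor_val_vector (eb_tensorKK eb) (@bidual_bops _ _ _ rho)
  (@bidual_bops _ _ _ rho) n1 n2 _ _ (eb_Phi_range eb a)).
- exact: normal_ext_bidual xi_val _ sm.
- exact: normal_ext_bidual xi_val _ sn.
Qed.

Lemma Phi_one : Phi e = id.
Proof.
have [Phi2 [h1 _ h2]] := eb_Phi_unital eb.
by rewrite -h1 (universal_rep_one he eb_rho_rep xi_dense).
Qed.

(** By [conv_vector] this is a vector functional of the unital *-homomorphism [Phi], at a tensor
    product of two unit vectors. *)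
Lemma conv_state mu nu : state mu -> state nu -> state (conv mu nu).
Proof.
move=> sm sn; have [_ Phil PhiM Phiadj] := eb_Phi_hom eb.
have xi1 := rnorm_state_vector he eb_rho_rep xi_val xi_dense.
apply: (@positive_unital_state _ _ _ he).
- by move=> c a b; rewrite !conv_vector // Phil innerDl innerZl.
- move=> a; rewrite conv_vector // PhiM Phiadj inner_self lecR; exact: sqr_ge0.
- rewrite conv_vector // -[1]/e Phi_one inner_self (rnorm_tensor (eb_tensorKK eb)).
  by rewrite !xi1 // mul1r expr1n.
Qed.

Lemma V_bops : bops V.
Proof. by case: (eb_V_range eb). Qed.

Lemma V_contraction z : rnorm (V z) <= rnorm z.
Proof. by have := eb_V_contraction eb z; rewrite !rnormE lecR. Qed.

Lemma V_lin (c : R[i]) x y : V (c *: x + y) = c *: V x + V y.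
Proof. by case: V_bops => ->. Qed.

Lemma rnorm_V_coef k k' h h' :
  rnorm '<V (tH k h), tH k' h'> <= (rnorm k * rnorm h) * (rnorm k' * rnorm h').
Proof.
apply: le_trans (cauchy_schwarz _ _) _; rewrite -!(rnorm_tensor tHP).
by apply: ler_wpM2r; [exact: rnorm_ge0 | exact: V_contraction].
Qed.

(** [riesz] returns 0 when no representing vector exists, so the slice means something only after
    its form is shown conjugate linear and bounded. *)
Lemma rsliceP v k k' : normal v ->
  '<rslice tH v V k, k'> = nval (rform tH k k' v) V.
Proof.
move=> nv; have [B hB] := normal_abs_bound nv.
pose g k' : R[i] := nval (rform tH k k' v) V.
have g_cvg x : series (fun m => '<V (tH k (v.1 m)), tH x (v.2 m)> : C) @ \oo --> (g x : C).
  exact: nval_cvg (normal_rform tHP k x nv) V_bops.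
apply: (@rieszP _ K g (rnorm k * B)).
  move=> c x y; apply: csumE.
  have := series_lin (c := Num.conj c) (g_cvg x) (g_cvg y).
  have -> // : (fun n => Num.conj c * '<V (tH k (v.1 n)), tH x (v.2 n)> +
      '<V (tH k (v.1 n)), tH y (v.2 n)> : C) =
    (fun n => '<V ((rform tH k (c *: x + y) v).1 n), (rform tH k (c *: x + y) v).2 n>).
  by apply/funext => n; rewrite /= (tensorDZl tHP) innerDr innerZr.
move=> x; apply: rnorm_limit_le (g_cvg x) _ => n; rewrite seriesEord /=.
apply: le_trans (rnorm_sum _ _ _) _.
have kx : 0 <= rnorm k * rnorm x by rewrite mulr_ge0 ?rnorm_ge0.
rewrite mulrAC; apply: le_trans (ler_wpM2l kx (hB n)); rewrite mulr_sumr.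
by apply: ler_sum => i _; apply: le_trans (rnorm_V_coef _ _ _ _) _; rewrite mulrACA.
Qed.

(** States are defined on [A] only, so the coefficients of [V] along [H] must be elements of [A];
    they are slices by vector functionals. *)
Lemma exists_coef : exists coef : H -> H -> A, forall h h' k k',
  '<rho (coef h h') k, k'> = '<V (tH k h), tH k' h'>.
Proof.
have /choice[f hf] : forall p : H * H, exists a, rslice tH (vform p.1 p.2) V = rho a.
  by move=> p; apply: (eb_slice_sub eb); apply: normal_vform.
exists (fun h h' => f (h, h')) => h h' k k'.
rewrite -hf rsliceP; last exact: normal_vform.
by rewrite (rform_vform tHP) nval_vform.
Qed.

Variable coef : H -> H -> A.
Hypothesis coefP : forall h h' k k',
  '<rho (coef h h') k, k'> = '<V (tH k h), tH k' h'>.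

Definition slice_op mu : H -> H := lslice tH (normal_ext rho mu) V.
Local Notation T := slice_op.

Lemma state_coef mu h h' : state mu ->
  mu (coef h h') = '<V (tH (xi mu) h), tH (xi mu) h'>.
Proof. by move=> sm; rewrite -coefP xi_val. Qed.

Lemma rnorm_state_coef mu h h' : state mu -> rnorm (mu (coef h h')) <= rnorm h * rnorm h'.
Proof.
move=> sm; rewrite state_coef //; apply: le_trans (rnorm_V_coef _ _ _ _) _.
by rewrite (rnorm_state_vector he eb_rho_rep xi_val xi_dense sm) !mul1r.
Qed.

Lemma slice_opP mu h h' : state mu -> '<T mu h, h'> = mu (coef h h').
Proof.
move=> sm; have [nw hw] := normal_extP xi_val sm.
have E x : csum (fun n => '<V (tH ((normal_ext rho mu).1 n) h),
    tH ((normal_ext rho mu).2 n) x>) = mu (coef h x).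
  rewrite -hw; congr csum; apply/funext => n; by rewrite coefP.
rewrite -E; apply: (@rieszP _ H _ (rnorm h)) => [c x y|x]; last first.
  by rewrite E rnorm_state_coef.
by rewrite !E !state_coef // (tensorDZr tHP) innerDr innerZr.
Qed.

Lemma slice_op_contraction mu h : state mu -> rnorm (T mu h) <= rnorm h.
Proof.
move=> sm; have := rnorm_state_coef h (T mu h) sm; rewrite -slice_opP // inner_self.
rewrite rnormR ger0_norm ?sqr_ge0 // expr2.
have [/rnorm0_eq0 ->|n0] := lerP (rnorm (T mu h)) 0; first by rewrite rnorm0 rnorm_ge0.
by rewrite ler_pM2r.
Qed.

(** Moving [T nu] to the other side of the inner product makes the coefficients of [T nu (T mu h)]
    values of [mu] at fixed elements of [A], hence weak-* continuous in [mu]. *)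
Lemma slice_op_adjoint nu h' : state nu -> exists s, forall h, '<T nu h, h'> = '<h, s>.
Proof.
move=> sn; have [|x|s hs] := @riesz_representation _ H
    (fun h => Num.conj (nu (coef h h'))) (rnorm h').
- move=> c x y; rewrite !state_coef // (tensorDZr tHP) V_lin innerDl innerZl.
  by rewrite rmorphD rmorphM.
- by rewrite rnorm_conj mulrC; apply: rnorm_state_coef.
by exists s => h; rewrite slice_opP // inner_conj hs conjCK.
Qed.

Lemma slice_op_conv mu nu h : state mu -> state nu -> T (conv mu nu) h = T mu (T nu h).
Proof.
by move=> [bm _ _ _] [bn _ _ _]; have := eb_slice_hom eb bm bn => /(congr1 (@^~ h)).
Qed.

Lemma slice_op_inj mu nu : state mu -> state nu -> T mu = T nu -> mu = nu.
Proof.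
move=> sm sn TT.
have val la a v : state la -> normal v -> rslice tH v V = rho a ->
    la a = csum (fun m => '<T la (v.1 m), v.2 m>).
  move=> sl nv va; rewrite -(xi_val a sl) -va rsliceP //; congr csum.
  by apply/funext => m; rewrite slice_opP // state_coef.
apply/funext => a; apply: rnorm_eq_eps => d d0.
have d2 : 0 < d / 2 by rewrite divr_gt0.
have balla : ball a (d / 2)%:C !=set0 by exists a; apply: ballxx; rewrite ltcR.
have [b [hb [v nv vb]]] := eb_slice_dense eb balla (ball_open _ _).
move: hb; rewrite ball_rnorm /= => hb.
have mnb : mu b = nu b by rewrite (val mu b v sm nv vb) TT -(val nu b v sn nv vb).
have st (la : A -> C) (x y : A) : state la -> rnorm (la x - la y) <= rnorm (x - y).
  by move=> sl; rewrite -stateB //; apply: state_rnorm.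
have := rnorm_dist (mu b) (mu a) (nu a); rewrite {2}mnb.
have := st mu a b sm; have := st nu b a sn; rewrite (rnormBC b a); lra.
Qed.

Lemma state_midpoint mu nu : state mu -> state nu ->
  state (fun a => (2^-1)%:C * (mu a + nu a) : C).
Proof.
move=> sm sn; apply: (@positive_unital_state _ _ _ he).
- move=> c a b; rewrite (state_linear sm) (state_linear sn).
  by rewrite -![_ *: _ : C]/(_ * _ : R[i]); ring.
- move=> a; case: sm => _ mp _ _; case: sn => _ np _ _.
  by rewrite mulr_ge0 ?addr_ge0 ?lecR ?mp ?np.
- have m1 : mu (1 : ualg he) = 1 := state_unital he sm.
  have n1 : nu (1 : ualg he) = 1 := state_unital he sn.
  rewrite m1 n1; apply/eqP; rewrite eq_complex /=.
  by apply/andP; split; apply/eqP; lra.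
Qed.

Lemma exists_fixing_vector h : exists2 mu, state mu &
  forall nu, state nu -> T nu (T mu h) = T mu h.
Proof.
pose D := [set rnorm (T mu h) | mu in @state R A].
have [m0 sm0] := exists_state he.
have hi : has_inf D.
  by split; [exists (rnorm (T m0 h)); exists m0 | exists 0 => _ [mu _ <-]; apply: rnorm_ge0].
pose d := inf D.
have dT mu : state mu -> d <= rnorm (T mu h).
  by move=> sm; apply: ge_inf; [case: hi | exists mu].
have d0 : 0 <= d by apply: lb_le_inf; [case: hi | move=> _ [mu _ <-]; apply: rnorm_ge0].
pose F := filter_from [set r : R | 0 < r]
  (fun r => [set mu | state mu /\ rnorm (T mu h) <= d + r]).
have FF : ProperFilter F.
  apply: filter_from_proper; last first.
    move=> r r0; have [_ [mu sm <-] hm] := inf_adherent r0 hi.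
    by exists mu; split=> //; apply: ltW.
  apply: filter_from_filter; first by exists 1 => /=.
  move=> i j /= i0 j0; exists (Num.min i j); first by rewrite /= lt_min i0.
  by move=> mu [sm hm]; split; split=> //; apply: le_trans hm _; rewrite lerD2l ge_min lexx ?orbT.
have [|M [sM hM]] := state_compact he FF; first by exists 1 => //= mu [].
have TMd : rnorm (T M h) <= d.
  apply/ler_addgt0Pr => r r0.
  (* Only bounds on single values [mu a] survive the limit, so the norm of [T M h] is recovered by
     testing it against itself. *)
  have h1 : rnorm (M (coef h (T M h))) <= (d + r) * rnorm (T M h).
    apply: hM; exists r => // mu [sm hm] /=; rewrite -slice_opP //.
    by apply: le_trans (cauchy_schwarz _ _) _; rewrite ler_wpM2r ?rnorm_ge0.
  move: h1; rewrite -slice_opP // inner_self rnormR ger0_norm ?sqr_ge0 // expr2.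
  have [n0|n0] := lerP (rnorm (T M h)) 0; first by move=> _; lra.
  by rewrite ler_pM2r.
exists M => // nu sn; have sc := conv_state sn sM.
have Tc : rnorm (T nu (T M h)) <= d by apply: le_trans (slice_op_contraction _ sn) TMd.
(* The midpoint of [M] and [conv nu M] competes in the infimum, so [T M h + T nu (T M h)] has norm
   at least [2 d] while each summand has norm at most [d]; the parallelogram law leaves no room for
   a difference. *)
have smid := state_midpoint sM sc.
have Tmid : T (fun a => (2^-1)%:C * (M a + conv nu M a)) h =
    (2^-1)%:C *: (T M h + T nu (T M h)).
  apply: inner_ext => z; rewrite slice_opP // innerZl innerDl -slice_op_conv //.
  by rewrite !slice_opP.
have := dT _ smid; rewrite Tmid rnormZ rnormR ger0_norm //.
have := parallelogram (T M h) (T nu (T M h)).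
move: (rnorm_ge0 (T M h)) (rnorm_ge0 (T nu (T M h))) (rnorm_ge0 (T M h + T nu (T M h))).
set p := rnorm _ in TMd *; set q := rnorm _ in Tc *; set s := rnorm (_ + _).
move=> p0 q0 s0 hpar hs; apply/esym/subr0_eq/rnorm0_eq0.
have : rnorm (T M h - T nu (T M h)) ^+ 2 <= 0 by rewrite hpar; nra.
by have := rnorm_ge0 (T M h - T nu (T M h)); set n := rnorm _; nra.
Qed.

(** A state [m2] chosen for the vector [T m1 h] does no harm to earlier entries [x]: [T m1 x] is
    already fixed by every state, [m2] included. *)
Lemma exists_fixing_seq (s : seq H) : exists2 mu, state mu &
  forall h nu, h \in s -> state nu -> T nu (T mu h) = T mu h.
Proof.
elim: s => [|h s [m1 s1 h1]].
  by have [m0 sm0] := exists_state he; exists m0.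
have [m2 s2 h2] := exists_fixing_vector (T m1 h).
exists (conv m2 m1); first exact: conv_state.
move=> x nu; rewrite in_cons slice_op_conv // => /orP[/eqP->|xs] sn; first exact: h2.
by rewrite (h1 x m2 xs s2) (h1 x nu xs sn).
Qed.

Lemma exists_left_invariant : exists2 M, state M &
  forall nu, state nu -> conv nu M = M.
Proof.
pose F := filter_from [set: seq H] (fun s => [set mu | state mu /\
  forall h nu, h \in s -> state nu -> T nu (T mu h) = T mu h]).
have FF : ProperFilter F.
  apply: filter_from_proper; last first.
    by move=> s _; have [mu sm hm] := exists_fixing_seq s; exists mu.
  apply: filter_from_filter; first by exists [::].
  move=> s s' _ _; exists (s ++ s') => // mu [sm hm].
  by split; split=> // h nu hs; apply: hm; rewrite mem_cat hs ?orbT.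
have [|M [sM hM]] := state_compact he FF; first by exists [::] => //= mu [].
exists M => // nu sn; apply: (slice_op_inj (conv_state sn sM) sM).
apply/funext => h; rewrite slice_op_conv //; apply: inner_ext => z.
have [s hs] := slice_op_adjoint z sn; rewrite hs !slice_opP //.
(* The equation is now the vanishing of [M] at one element of [A], a closed condition of radius 0
   that holds for all states fixing the image of [h]. *)
apply/subr0_eq/rnorm0_eq0; rewrite -stateB //; apply: hM.
exists [:: h] => // mu [sm hm] /=.
by rewrite stateB // -!slice_opP // -hs hm ?mem_head // subrr rnorm0.
Qed.

End Eberlein.

Theorem theorem4p6 (R : realType) (A : cstarType R)
    (K H KK KH : hilbertType R)
    (pi : A -> K -> K) (tK : K -> K -> KK) (tH : K -> H -> KH)
    (Phi : A -> KK -> KK) (V : KH -> KH) :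
  unital A ->
  cstar_eberlein pi tK tH Phi V ->
  exists M : A -> R[i]^o, left_invariant_mean pi tK Phi M.
Proof.
move=> [e he] eb; have [_ [xi [xi_val _ xi_dense]]] := eb_universal eb.
have xi_val' mu a : state mu -> '<pi a (xi mu), xi mu> = mu a by apply: xi_val.
have [coef coefP] := exists_coef eb.
have [M sM MP] := exists_left_invariant he eb xi_val' xi_dense coefP.
exists M; split=> // mu a smu.
by rewrite /bidual_act /canon MP.
Qed.
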